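(* Let $n\ge 1$ and let $\xi_0,\dots,\xi_n$ be independent real random variables with probability density functions $f_0,\dots,f_n$. Let $G(x)=\xi_nx^n+\dots+\xi_1x+\xi_0$, and let $\rho_k$, $1\le k\le n$, denote the $k$-th correlation function of the real zeros of $G$. Then for every $k\in\{1,\dots,n\}$ and $\mathbf{x}=(x_1,\dots,x_k)\in\mathbb{R}^k$ with pairwise distinct coordinates, $$ \rho_k(\mathbf{x}) = \prod_{1\leq i<j\leq k}|x_i-x_j|^{-1}\;\mathbb{E}\left[\prod_{i=1}^{k}\left|\sum_{j=0}^{k-1}j\,\eta_j(\mathbf{x})x_i^{j-1}+\sum_{j=k}^{n}j\,\xi_j x_i^{j-1}\right|\prod_{i=0}^{k-1}f_i(\eta_i(\mathbf{x}))\right], $$ where the random function $\eta=(\eta_0,\dots,\eta_{k-1})^T$ is defined by $$ \eta(\mathbf{x})=-V^{-1}(\mathbf{x})\begin{pmatrix}\sum_{j=k}^n\xi_jx_1^j\\ \vdots\\ \sum_{j=k}^n\xi_jx_k^j\end{pmatrix}, $$ with $V(\mathbf{x})=(x_i^{j-1})_{1\le i,j\le k}$ the Vandermonde matrix.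
   Context: With probability one all zeros of $G$ are simple. Let $\mu=\sum_{x\in\mathbb{R}:\,G(x)=0}\delta_x$ be the empirical measure counting the real zeros of $G$, where $\delta_x$ is the unit point mass at $x$. The correlation functions (joint intensities) of $\mu$ are functions $\rho_k:\mathbb{R}^k\to\mathbb{R}^+$, $k=1,\dots,n$, such that for any family of mutually disjoint Borel subsets $B_1,\dots,B_k\subset\mathbb{R}$, $$\mathbb{E}\left[\prod_{i=1}^{k}\mu(B_i)\right]=\int_{B_1}\cdots\int_{B_k}\rho_k(x_1,\dots,x_k)\,dx_1\cdots dx_k .$$ Since this property determines $\rho_k$ only up to Lebesgue-null sets, the formula for $\rho_k$ is understood to mean that the right-hand side is a version of the $k$-th correlation function, i.e. it satisfies this identity for all mutually disjoint Borel sets $B_1,\dots,B_k$. Terms $j\,c\,x^{j-1}$ with $j=0$ are equal to $0$ (also at $x=0$), $x^0=1$ for all $x$, and an empty product equals $1$. *)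

(* Defs.v *)
From HB Require Import structures.
From mathcomp Require Import all_boot all_order all_algebra.
From mathcomp Require Import all_classical all_reals all_analysis.
From mathcomp Require Import measurable_realfun.

Set Implicit Arguments.
Unset Strict Implicit.
Unset Printing Implicit Defensive.

Import Order.TTheory GRing.Theory Num.Theory.

Local Open Scope classical_set_scope.
Local Open Scope ring_scope.

Definition mutually_independent (d : measure_display) (T : measurableType d)
    (R : realType) (P : probability T R) (I : finType)
    (X : I -> {RV P >-> R}) : Prop :=
  forall (J : {set I}) (A : I -> set R), (forall i, measurable (A i)) ->
    P (\bigcap_(i in [set` J]) (X i @^-1` A i)) =
    (\prod_(i in J) P (X i @^-1` A i))%E.

Definition has_density (d : measure_display) (T : measurableType d)
    (R : realType) (P : probability T R) (X : {RV P >-> R}) (f : R -> R) :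
    Prop :=
  [/\ measurable_fun [set: R] f,
      forall x, 0 <= f x &
      forall A : set R, measurable A ->
        distribution P X A = (\int[lebesgue_measure]_(x in A) (f x)%:E)%E].

(* [c j] is the coefficient of degree [j]. *)
Definition poly_of_coefs (R : realType) (n : nat) (c : 'I_n.+1 -> R) : {poly R} :=
  \sum_(j < n.+1) c j *: 'X^j.

(* For p = 0 every real is a zero, and B gets infinite mass if B is infinite. *)
Definition real_zeros_measure (R : realType) (p : {poly R}) (B : set R) :
    \bar R :=
  (\esum_(x in [set x : R | root p x]) \d_x B)%E.

Fixpoint iterated_integral (R : realType) (k : nat) :
    ('I_k -> set R) -> (k.-tuple R -> \bar R) -> \bar R :=
  match k with
  | 0 => fun _ F => F [tuple]
  | k'.+1 => fun B F =>
      (\int[lebesgue_measure]_(x in B ord0)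
         iterated_integral (fun i => B (lift ord0 i))
                           (fun y : k'.-tuple R => F [tuple of x :: y]))%E
  end.

(* [rho] is a version of the k-th correlation function of the random measure
   [mu].  Values of [rho] at points with two equal coordinates are
   unconstrained: such points never lie in a product of disjoint sets.  Values
   are extended reals because a version may be infinite on a null set.
   Measurability is required explicitly because the library integral is
   defined for arbitrary functions. *)
Definition is_correlation_function (d : measure_display)
    (T : measurableType d) (R : realType) (P : probability T R)
    (mu : T -> set R -> \bar R) (k : nat) (rho : k.-tuple R -> \bar R) :
    Prop :=
  [/\ forall x : k.-tuple R, uniq x -> (0 <= rho x)%E,
      measurable_fun [set x : k.-tuple R | uniq x] rho &
      forall B : 'I_k -> set R, (forall i, measurable (B i)) ->
        (forall i j, i != j -> B i `&` B j = set0) ->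
        measurable_fun [set: T] (fun w => (\prod_(i < k) mu w (B i))%E) /\
        (\int[P]_w (\prod_(i < k) mu w (B i)) = iterated_integral B rho)%E].

Definition vandermonde_mx (R : realType) (k : nat) (x : k.-tuple R) :
    'M[R]_k :=
  \matrix_(i < k, j < k) tnth x i ^+ j.

Definition eta_col (R : realType) (n k : nat) (c : 'I_n.+1 -> R)
    (x : k.-tuple R) : 'cV[R]_k :=
  - invmx (vandermonde_mx x) *m
    \col_(i < k) \sum_(j < n.+1 | (k <= j)%N) c j * tnth x i ^+ j.

(* Main.v *)
(* Erase the coefficient xi_m and resample it: by independence,
   E[F(xi_m, rest)] = E[int f_m(y) F(y, rest) dy].  Once x_1, ..., x_m are fixed
   and xi_0, ..., xi_(m-1) are the values for which the polynomial vanishes at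
   them, that polynomial is Q (y + g), where y = xi_m, Q = prod (X - x_i) and g
   is the quotient by Q of the polynomial without its term of degree m, so its
   remaining zeros are the solutions z of y = - g(z).  The one-dimensional area formula for g turns
   int ... #{z in B : y + g(z) = 0} dy into int_B ... |g'(z)| dz, and at
   y = - g(z) the polynomial is the one that also vanishes at z.  Its derivative
   at z is Q(z) g'(z), which accounts for the factors |x_i - z|^-1.  Tonelli's
   theorem moves dz outside of the expectation, and k such steps, one nested
   integral at a time, give the formula: no k-dimensional change of variables
   is needed. *)

Require Import Defs.
From HB Require Import structures.
From mathcomp Require Import all_boot all_order all_algebra.
From mathcomp Require Import all_classical all_reals all_analysis.
From mathcomp Require Import measurable_realfun.
From mathcomp Require Import polyrcf ring.

Set Implicit Arguments.
Unset Strict Implicit.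
Unset Printing Implicit Defensive.

Import Order.TTheory GRing.Theory Num.Theory.
Import numFieldNormedType.Exports.

Local Open Scope classical_set_scope.
Local Open Scope ring_scope.

(** * The zero-counting measure of a polynomial *)

Lemma mem_rootsR (R : realType) (p : {poly R}) x :
  p != 0 -> (x \in rootsR p) = root p x.
Proof.
by move=> p0; rewrite (roots_onP (roots_on_rootsR p0)) // in_itv.
Qed.

(** A finite sum of Dirac masses is already a measure, so countable additivity of the zero count is
    inherited from it whenever [p != 0]. *)
Definition roots_dirac_sum (R : realType) (p : {poly R}) : {measure set R -> \bar R} :=
  msum (fun i => \d_((rootsR p)`_i)) (size (rootsR p)).

Lemma real_zeros_measure_sum (R : realType) (p : {poly R}) (B : set R) :
  p != 0 -> real_zeros_measure p B = (\sum_(x <- rootsR p) \d_x B)%E.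
Proof.
move=> p0; rewrite /real_zeros_measure.
have -> : [set x : R | root p x] = [set` rootsR p].
  by apply/seteqP; split=> x /=; rewrite mem_rootsR.
rewrite esum_fset; [|exact: finite_seq|by []].
by rewrite [RHS]fsbig_seq//; exact: uniq_roots.
Qed.

Lemma real_zeros_measureE (R : realType) (p : {poly R}) (B : set R) :
  p != 0 -> real_zeros_measure p B = roots_dirac_sum p B.
Proof.
by move=> p0; rewrite real_zeros_measure_sum// (big_nth 0) big_mkord.
Qed.

Lemma eq_real_zeros_measure (R : realType) (p q : {poly R}) (B : set R) :
  (forall x, B x -> root p x = root q x) ->
  real_zeros_measure p B = real_zeros_measure q B.
Proof.
move=> pq; rewrite /real_zeros_measure esum_mkcond [RHS]esum_mkcond.
apply: eq_esum => x _; rewrite diracE.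
have [xB|xB] := boolP (x \in B); last by do 2 case: ifP.
congr (if _ then _ else _).
by apply/idP/idP; rewrite !inE/= pq//; exact/set_mem.
Qed.

Lemma real_zeros_measure_ge0 (R : realType) (p : {poly R}) (B : set R) :
  (0 <= real_zeros_measure p B)%E.
Proof. by apply: esum_ge0. Qed.

Lemma real_zeros_measure_eq0 (R : realType) (p : {poly R}) (B : set R) :
  (forall x, B x -> ~~ root p x) -> real_zeros_measure p B = 0%E.
Proof.
move=> pB; rewrite /real_zeros_measure esum1// => x /= px.
by rewrite diracE memNset// => /pB; rewrite px.
Qed.

Lemma real_zeros_measure_eq1 (R : realType) (p : {poly R}) (B : set R) x :
  B x -> root p x -> (forall y, B y -> root p y -> y = x) ->
  real_zeros_measure p B = 1%E.
Proof.
move=> Bx px xP.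
rewrite (@eq_real_zeros_measure _ _ ('X - x%:P)).
  rewrite /real_zeros_measure (_ : [set y | root ('X - x%:P) y] = [set x]).
    by rewrite esum_set1// diracE mem_set.
  by apply/seteqP; split=> y /=; rewrite root_XsubC => /eqP.
by move=> y By; rewrite root_XsubC; apply/idP/eqP => [/(xP _ By)|->].
Qed.

Lemma real_zeros_measure_bigcup (R : realType) (p : {poly R}) (F : (set R)^nat) :
  p != 0 -> (forall i, measurable (F i)) -> trivIset setT F ->
  real_zeros_measure p (\bigcup_i F i) =
  (\sum_(0 <= i <oo) real_zeros_measure p (F i))%E.
Proof.
move=> p0 mF tF; rewrite real_zeros_measureE// measure_semi_bigcup//.
  by apply: eq_eseriesr => i _; rewrite real_zeros_measureE.
exact: bigcupT_measurable.
Qed.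

(** Measurability of a random polynomial is expressed through its coefficients. The uniform degree
    bound turns evaluation and products into finite sums of fixed length. *)
Definition measurable_poly_fun (d : measure_display) (U : measurableType d)
    (R : realType) (p : U -> {poly R}) : Prop :=
  (exists N, forall u, (size (p u) <= N)%N) /\
  forall i, measurable_fun [set: U] (fun u => (p u)`_i).

(** * Closure properties of measurable families of polynomials *)

Section measurable_poly_fun.
Context (d : measure_display) (U : measurableType d) (R : realType).
Implicit Types (p q : U -> {poly R}) (x : U -> R).

Lemma measurable_poly_horner p x : measurable_poly_fun p ->
  measurable_fun [set: U] x -> measurable_fun [set: U] (fun u => (p u).[x u]).
Proof.
move=> [[N sp] mp] mx.
under eq_fun do rewrite (horner_coef_wide _ (sp _)).
apply: measurable_sum => i; apply: measurable_funM => //.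
exact: measurable_funX.
Qed.

Lemma measurable_poly_deriv p : measurable_poly_fun p ->
  measurable_poly_fun (fun u => (p u)^`()).
Proof.
move=> [[N sp] mp]; split.
  exists N => u; have [->|p0] := eqVneq (p u) 0; first by rewrite deriv0 size_poly0.
  by rewrite (leq_trans _ (sp u))// ltnW// lt_size_deriv.
move=> i; under eq_fun do rewrite coef_deriv -mulr_natr.
exact: measurable_funM.
Qed.

Lemma measurable_polyD p q : measurable_poly_fun p -> measurable_poly_fun q ->
  measurable_poly_fun (fun u => p u + q u).
Proof.
move=> [[N sp] mp] [[M sq] mq]; split.
  exists (maxn N M) => u; rewrite (leq_trans (size_polyD _ _))//.
  by rewrite geq_max !leq_max sp sq orbT.
by move=> i; under eq_fun do rewrite coefD; exact: measurable_funD.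
Qed.

Lemma measurable_polyM p q : measurable_poly_fun p -> measurable_poly_fun q ->
  measurable_poly_fun (fun u => p u * q u).
Proof.
move=> [[N sp] mp] [[M sq] mq]; split.
  exists (N + M)%N => u; rewrite (leq_trans (size_polyMleq _ _))//.
  by rewrite (leq_trans (leq_pred _))// leq_add.
move=> i; under eq_fun do rewrite coefM.
by apply: measurable_sum => j; exact: measurable_funM.
Qed.

Lemma measurable_polyC x : measurable_fun [set: U] x ->
  measurable_poly_fun (fun u => (x u)%:P).
Proof.
move=> mx; split; first by exists 1%N => u; rewrite size_polyC leq_b1.
by case=> [|i]; under eq_fun do rewrite coefC/=; [exact: mx|exact: measurable_cst].
Qed.

Lemma measurable_poly_cst (p : {poly R}) : measurable_poly_fun (fun _ : U => p).
Proof. by split=> [|i]; [exists (size p)|exact: measurable_cst]. Qed.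

Lemma measurable_poly_XsubC x : measurable_fun [set: U] x ->
  measurable_poly_fun (fun u => 'X - (x u)%:P).
Proof.
move=> mx; under eq_fun do rewrite -polyCN.
apply: measurable_polyD; first exact: measurable_poly_cst.
by apply: measurable_polyC; exact: measurableT_comp.
Qed.

Lemma measurable_poly_sum (I : Type) (s : seq I) (p : I -> U -> {poly R}) :
  (forall i, measurable_poly_fun (p i)) ->
  measurable_poly_fun (fun u => \sum_(i <- s) p i u).
Proof.
move=> mp; elim: s => [|i s IH].
  by under eq_fun do rewrite big_nil; exact: measurable_poly_cst.
by under eq_fun do rewrite big_cons; exact: measurable_polyD.
Qed.

(* Synthetic division: q_i = p_(i+1) + x q_(i+1). *)
Lemma measurable_poly_divp_XsubC p x : measurable_poly_fun p ->
  measurable_fun [set: U] x -> measurable_poly_fun (fun u => p u %/ ('X - (x u)%:P)).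
Proof.
move=> [[N sp] mp] mx.
have sq u : (size (p u %/ ('X - (x u)%:P))%R <= N)%N.
  by rewrite (leq_trans (leq_divp _ _)).
split; first by exists N.
have rec u i : (p u %/ ('X - (x u)%:P))`_i =
    (p u)`_i.+1 + x u * (p u %/ ('X - (x u)%:P))`_i.+1.
  have r0 : (p u %% ('X - (x u)%:P))`_i.+1 = 0.
    rewrite nth_default//; apply: (@leq_trans 1) => //.
    by rewrite -ltnS -[X in (_ < X)%N](size_XsubC (x u)) ltn_modp polyXsubC_eq0.
  have -> : (p u)`_i.+1 = (p u %/ ('X - (x u)%:P))`_i
      - x u * (p u %/ ('X - (x u)%:P))`_i.+1.
    rewrite [in LHS](divp_eq (p u) ('X - (x u)%:P)) coefD r0 addr0.
    by rewrite mulrBr coefB coefMX coefMC/= mulrC.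
  by rewrite subrK.
(* Descending induction on the index: the coefficients of the quotient vanish from [N] on, and the
   recursion expresses each one through the next. *)
suff H k i : (N <= i + k)%N ->
    measurable_fun [set: U] (fun u => (p u %/ ('X - (x u)%:P))`_i).
  by move=> i; apply: (H N); rewrite leq_addl.
elim: k i => [|k IH] i Ni.
  rewrite addn0 in Ni.
  rewrite (_ : (fun _ => _) = cst 0); first exact: measurable_cst.
  by apply/funext => u; rewrite nth_default// (leq_trans (sq u)).
under eq_fun do rewrite rec.
apply: measurable_funD => //; apply: measurable_funM => //.
by apply: IH; rewrite addSnnS.
Qed.

End measurable_poly_fun.

(** Says that at least [t] distinct roots lie below [a]; the decreasing chain lets them be peeled
    off one at a time from the top. *)
Definition descending_roots (R : realType) (p : {poly R}) (t : nat) (a : R) :=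
  exists s : seq R, [/\ size s = t, path (fun x y => y < x) a s & all (root p) s].

Lemma descending_roots0 (R : realType) (p : {poly R}) (a : R) :
  descending_roots p 0 a.
Proof. by exists [::]. Qed.

(** The top root of the chain is isolated in a rational interval with the remaining roots below it.
    Quantifying over rationals only makes the recursion a countable union. *)
Lemma descending_rootsS (R : realType) (p : {poly R}) (t : nat) (a : R) :
  descending_roots p t.+1 a <->
  exists q q' : rat, [/\ ratr q < ratr q' :> R, ratr q' < a,
    descending_roots p t (ratr q) &
    exists2 x, x \in `[ratr q : R, ratr q'] & root p x].
Proof.
split.
  case=> -[[]//|x s] [] /= /eqP; rewrite eqSS => /eqP sst /andP[xa xs] /andP[px ps].
  have [q'] := rat_in_itvoo xa; rewrite in_itv/= => /andP[xq' q'a].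
  (* [y] is the next root of the chain, or [x - 1] if there is none; [q] is then chosen between [y]
     and [x]. *)
  have [y yx ys] : exists2 y, y < x & path (fun x y => y < x) y s \/ exists s', s = y :: s'.
    case: s xs {sst ps} => [|y s] /=; first by exists (x - 1); [rewrite ltrBlDr ltrDl|left].
    by case/andP => yx _; exists y => //; right; exists s.
  have [q] := rat_in_itvoo yx; rewrite in_itv/= => /andP[yq qx].
  exists q, q'; split=> //; first exact: lt_trans xq'.
    exists s; split=> //; case: s xs ys {sst ps} => [|z s]//= /andP[_ ->] ys.
    by rewrite andbT; case: ys => [/andP[zy _]|[s' [-> _]]] //; exact: lt_trans zy yq.
  by exists x; rewrite // in_itv/= !ltW.
move=> [q [q' [qq' q'a [s [sst qs ps]] [x]]]].
rewrite in_itv/= => /andP[qx xq'] px.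
exists (x :: s); split=> /=; rewrite ?sst ?px// (le_lt_trans xq' q'a)/=.
case: s qs {sst ps} => //= y s /andP[yq ->]; rewrite andbT.
exact: lt_le_trans qx.
Qed.

Lemma descending_rootsP (R : realType) (p : {poly R}) (t : nat) (a : R) :
  p != 0 -> descending_roots p t a <-> (t <= count (fun x => (x < a)%R) (rootsR p))%N.
Proof.
move=> p0; have gt_trans : transitive (fun x y : R => y < x).
  by move=> y x z yx zy; exact: lt_trans yx.
rewrite -size_filter; split.
  move=> [s [<- as_ ps]]; apply: uniq_leq_size.
    by apply: sorted_uniq (path_sorted as_) => // x; rewrite /= ltxx.
  move=> x xs; rewrite mem_filter mem_rootsR// (allP ps _ xs) andbT.
  by have /allP/(_ _ xs) := order_path_min gt_trans as_.
set l := [seq x <- rootsR p | x < a] => tl; exists (take t (rev l)).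
rewrite size_takel ?size_rev//; split=> //.
  apply: take_path; rewrite path_sortedE//; apply/andP; split.
    by rewrite all_rev; exact: filter_all.
  by rewrite rev_sorted; apply: sorted_filter; [exact: lt_trans|exact: sorted_roots].
apply/allP => x /mem_take; rewrite mem_rev mem_filter => /andP[_].
by rewrite mem_rootsR.
Qed.

(** * Measurability of the number of zeros in a Borel set *)

Section measurable_zeros.
Context (d : measure_display) (U : measurableType d) (R : realType).
Variable p : U -> {poly R}.
Hypothesis mp : measurable_poly_fun p.

(** By compactness, a root exists in the interval exactly when the absolute value of the polynomial
    takes arbitrarily small values at its rational points, which is a countable condition. *)
Let measurable_has_root (a b : R) : a < b ->
  measurable [set u | exists2 x, x \in `[a, b] & root (p u) x].
Proof.
move=> ab.
rewrite (_ : [set _ | _] = \bigcap_m \bigcup_(q : rat)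
  [set u | a <= ratr q <= b /\ `|(p u).[ratr q]| < m.+1%:R^-1]).
  apply: bigcapT_measurable => m; apply: bigcupT_measurable_rat => q.
  have [abq|abq] := boolP (a <= ratr q <= b); last first.
    by rewrite (_ : [set _ | _] = set0)// -subset0 => u [].
  rewrite (_ : [set _ | _] =
      (fun u => `|(p u).[ratr q]|) @^-1` `]-oo, m.+1%:R^-1[%classic); last first.
    by apply/seteqP; split=> u /=; rewrite in_itv/=; [case|split].
  rewrite -[X in measurable X]setTI.
  have : measurable_fun setT (fun u => `|(p u).[ratr q]|).
    apply: measurableT_comp => //; apply: measurable_poly_horner => //.
  by apply => //; exact: measurable_itv.
apply/seteqP; split=> u /=.
  move=> [x]; rewrite in_itv/= => /andP[ax xb] px m _.
  have [e e0 Pe] := @poly_cont _ x (p u) m.+1%:R^-1 (ltac:(by rewrite invr_gt0)).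
  (* The root may be an endpoint, so the rational is sought in the part of its neighbourhood that
     lies inside []a, b[]. *)
  have : Num.max a (x - e) < Num.min b (x + e).
    rewrite lt_min !gt_max ab; apply/and3P; split.
    - by rewrite ltrBlDr (le_lt_trans xb)// ltrDl.
    - by rewrite (le_lt_trans ax)// ltrDl.
    - by rewrite ltrBlDr -addrA ltrDl addr_gt0.
  move=> /rat_in_itvoo[q]; rewrite in_itv/= gt_max lt_min.
  move=> /andP[/andP[aq xq] /andP[qb qx]]; exists q => //; split.
    by rewrite !ltW.
  have := Pe (ratr q); rewrite (rootP px) subr0; apply.
  by rewrite ltr_distl xq qx.
move=> H.
have cp : {within `[a, b], continuous (fun x => `|(p u).[x]|)}.
  apply: continuous_subspaceT => x; apply: continuous_comp; first exact: continuous_horner.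
  exact: norm_continuous.
(* If the minimum of the absolute value were positive, some [m.+1%:R^-1] would lie below it and no
   rational point could do better. *)
have [c cab cmin] := EVT_min (ltW ab) cp.
exists c => //; apply/contraT => pc.
have : 0 < `|(p u).[c]| by rewrite normr_gt0.
move=> /ltr_add_invr[m]; rewrite add0r => mc.
have [q _ [abq qm]] := H m I.
have := cmin (ratr q); rewrite in_itv/= => /(_ abq).
by rewrite leNgt (lt_trans qm mc).
Qed.

Let measurable_descending_roots (t : nat) (a : R) :
  measurable [set u | descending_roots (p u) t a].
Proof.
elim: t a => [|t IH] a.
  rewrite (_ : [set _ | _] = setT)// -subTset => u _; exact: descending_roots0.
rewrite (_ : [set _ | _] = \bigcup_(q : rat) \bigcup_(q' : rat)
  [set u | [/\ ratr q < ratr q' :> R, ratr q' < a, descending_roots (p u) t (ratr q) &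
    exists2 x, x \in `[ratr q : R, ratr q'] & root (p u) x]]); last first.
  apply/seteqP; split=> u /=.
    by move/descending_rootsS => [q [q' H]]; exists q => //; exists q'.
  by move=> [q _ [q' _ H]]; apply/descending_rootsS; exists q, q'.
apply: bigcupT_measurable_rat => q; apply: bigcupT_measurable_rat => q'.
have [qq'|qq'] := boolP (ratr q < ratr q' :> R); last first.
  by rewrite (_ : [set _ | _] = set0)// -subset0 => u [].
have [q'a|q'a] := boolP (ratr q' < a); last first.
  by rewrite (_ : [set _ | _] = set0)// -subset0 => u [].
rewrite (_ : [set _ | _] = [set u | descending_roots (p u) t (ratr q)] `&`
    [set u | exists2 x, x \in `[ratr q : R, ratr q'] & root (p u) x]).
  by apply: measurableI => //; exact: measurable_has_root.
by apply/seteqP; split=> u /=; case.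
Qed.

(** The count is the sum over [t] of the indicators of having at least [t.+1] roots below [a]; the
    degree bound makes this sum finite. *)
Let measurable_zeros_ray (a : R) : (forall u, p u != 0) ->
  measurable_fun setT (fun u => real_zeros_measure (p u) `]-oo, a[%classic).
Proof.
move=> p0; have [[D sp] _] := mp.
rewrite (_ : (fun u => _) = (fun u =>
    \sum_(t < D) (\1_[set u | descending_roots (p u) t.+1 a] u)%:E)%E).
  apply: emeasurable_sum => t; apply/measurable_EFinP.
  by apply: measurable_indic; exact: measurable_descending_roots.
apply/funext => u; rewrite real_zeros_measure_sum//.
under eq_bigr do rewrite diracE.
rewrite !sumEFin; congr EFin.
pose c := count (fun x => x < a) (rootsR (p u)).
transitivity (c%:R : R).
  rewrite /c -sum1_count [in RHS]big_mkcond/= natr_sum; apply: eq_bigr => x _.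
  by rewrite mem_setE in_itv/=; case: (x < a).
transitivity ((\sum_(t < D) (t < c)%N)%:R : R).
  congr (_%:R).
  have cD : (c <= D)%N.
    rewrite (leq_trans (count_size _ _))// (leq_trans _ (sp u))// ltnW//.
    apply: max_poly_roots => //; last exact: uniq_roots.
    by apply/allP => x; rewrite mem_rootsR.
  elim: D c cD {sp} => [|D IH] c; first by rewrite leqn0 big_ord0 => /eqP.
  rewrite leq_eqVlt big_ord_recr/= => /orP[/eqP->|].
    rewrite (eq_bigr (fun=> 1%N)) ?sum_nat_const ?card_ord ?muln1 ?ltnSn ?addn1//.
    by move=> t _; rewrite (ltn_trans (ltn_ord t)).
  by rewrite ltnS => cD; rewrite [(D < c)%N]ltnNge cD addn0; exact: IH.
rewrite natr_sum; apply: eq_bigr => t _; rewrite indicE.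
congr ((nat_of_bool _)%:R); apply/idP/idP.
  by move=> tc; rewrite inE; apply/descending_rootsP.
by rewrite inE => /descending_rootsP; apply.
Qed.

Lemma measurable_real_zeros_measure_neq0 (B : set R) : (forall u, p u != 0) -> measurable B ->
  measurable_fun setT (fun u => real_zeros_measure (p u) B).
Proof.
move=> p0 mB.
have NE C u : real_zeros_measure (p u) C = roots_dirac_sum (p u) C.
  exact: real_zeros_measureE.
have fin C u : measurable C -> real_zeros_measure (p u) C \is a fin_num.
  move=> mC; rewrite real_zeros_measure_sum//; under eq_bigr do rewrite diracE.
  by rewrite sumEFin.
(* The total count, a limit along growing rays, serves the complement case of the Dynkin argument,
   where finiteness of the counts allows subtraction. *)
have mT : measurable_fun setT (fun u => real_zeros_measure (p u) setT).
  apply: (emeasurable_fun_cvg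
    (fun n u => real_zeros_measure (p u) `]-oo, n%:R[%classic)).
    by move=> n; exact: measurable_zeros_ray.
  move=> u _; under eq_cvg do rewrite NE; rewrite NE.
  rewrite (_ : setT = \bigcup_n `]-oo, (n%:R : R)[%classic); last first.
    by apply/esym; rewrite -subTset => x _; exists (Num.truncn `|x|).+1 => //=;
      rewrite in_itv/= (le_lt_trans (ler_norm _))// truncnS_gt.
  apply: nondecreasing_cvg_mu => //; first exact: bigcupT_measurable.
  move=> m n mn; apply/subsetPset => x /=; rewrite !in_itv/= => /lt_le_trans; apply.
  by rewrite ler_nat.
have GE : @measurable _ R = <<s RGenInftyO.G (R:=R) >>.
  exact: RGenInftyO.measurableE.
have sB : <<s RGenInftyO.G (R:=R) >> B by rewrite -GE.
apply: (@dynkin_induction _ R _ (fun B => measurable_fun setT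
  (fun u => real_zeros_measure (p u) B)) GE) sB => //.
- move=> _ _ [a ->] [b ->]; exists (Num.min a b); apply/seteqP; split=> x /=;
  by rewrite !in_itv/= lt_min => /andP.
- by move=> _ [a ->]; exact: measurable_zeros_ray.
- move=> S mS mfS.
  rewrite (_ : (fun u => _) = (fun u => real_zeros_measure (p u) setT
      - real_zeros_measure (p u) S)%E); first exact: emeasurable_funB.
  apply/funext => u; rewrite -[in RHS](setvU S) !NE measureU//; last 2 first.
  - exact: measurableC.
  - by rewrite setICl.
  by rewrite addeK//; have := fin S u mS; rewrite NE.
- move=> F mF tF mfF.
  rewrite (_ : (fun u => _) =
      (fun u => \sum_(0 <= i <oo) real_zeros_measure (p u) (F i))%E).
    by apply: ge0_emeasurable_sum => // i u _ _; exact: real_zeros_measure_ge0.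
  by apply/funext => u; rewrite real_zeros_measure_bigcup.
Qed.

End measurable_zeros.

Lemma measurable_real_zeros_measure (d : measure_display) (U : measurableType d)
    (R : realType) (p : U -> {poly R}) (B : set R) :
  measurable_poly_fun p -> measurable B ->
  measurable_fun [set: U] (fun u => real_zeros_measure (p u) B).
Proof.
move=> mp mB; have [[D sp] mpi] := mp.
have mZ : measurable_fun [set: U] (fun u => p u == 0).
  apply: (measurable_fun_bool true); rewrite setTI.
  rewrite (_ : _ @^-1` _ = \bigcap_i ((fun u => (p u)`_i) @^-1` [set 0])).
    apply: bigcapT_measurable => i; rewrite -[X in measurable X]setTI.
    by apply: mpi => //; exact: measurable_set1.
  apply/seteqP; split=> u /=.
    by move=> pu i _ /=; have /eqP-> : p u == 0 by []; rewrite coef0.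
  by move=> H; apply/eqP/polyP => i; rewrite coef0; exact: H.
(* The zero polynomial is replaced by a harmless constant, so that the previous lemma applies; on
   the measurable event [p u == 0] the count is a constant. *)
pose q u := if p u == 0 then 1 else p u.
have mq : measurable_poly_fun q.
  split; first by exists (maxn 1 D) => u; rewrite /q; case: ifP;
    rewrite ?size_poly1 leq_max ?sp ?orbT.
  move=> i; rewrite (_ : (fun u => _) =
     (fun u => if p u == 0 then (1 : {poly R})`_i else (p u)`_i)).
    exact: measurable_fun_ifT.
  by apply/funext => u; rewrite /q; case: ifP.
rewrite (_ : (fun u => _) = (fun u => if p u == 0 then real_zeros_measure (0 : {poly R}) B
  else real_zeros_measure (q u) B)).
  apply: measurable_fun_ifT => //; apply: measurable_real_zeros_measure_neq0 => // u.
  by rewrite /q; case: ifPn => // _; exact: oner_neq0.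
by apply/funext => u; rewrite /q; case: eqVneq => [->|].
Qed.

(** * The area formula for polynomials *)

Section density_measure.
Context (d : measure_display) (U : measurableType d) (R : realType).
Variables (mu : {measure set U -> \bar R}) (w : U -> \bar R).
Hypotheses (mw : measurable_fun [set: U] w) (w0 : forall x, (0 <= w x)%E).

(* The hypotheses are arguments so that the measure instance can mention them. *)
Definition density_measure (_ : measurable_fun [set: U] w)
    (_ : forall x, (0 <= w x)%E) (A : set U) : \bar R :=
  (\int[mu]_(x in A) w x)%E.

Local Notation dm := (density_measure mw w0).

Let dm0 : dm set0 = 0%E.
Proof. exact: integral_set0. Qed.

Let dm_ge0 A : (0 <= dm A)%E.
Proof. by apply: integral_ge0 => x _. Qed.

Let dm_sigma_additive : semi_sigma_additive dm.
Proof.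
move=> F mF tF mUF; rewrite /density_measure ge0_integral_bigcup//; last first.
  exact: measurable_funTS.
by apply: is_cvg_ereal_nneg_natsum_cond => n _ _; apply: integral_ge0.
Qed.

HB.instance Definition _ := isMeasure.Build _ _ _ dm dm0 dm_ge0 dm_sigma_additive.

Import HBNNSimple.

(** On indicators this is [nuE]; linearity gives simple functions, and monotone convergence the
    rest. *)
Lemma ge0_integral_density (nu : {measure set U -> \bar R}) (h : U -> \bar R) :
  (forall A, measurable A -> nu A = (\int[mu]_(x in A) w x)%E) ->
  (forall x, w x \is a fin_num) ->
  measurable_fun [set: U] h -> (forall x, (0 <= h x)%E) ->
  (\int[nu]_x h x = \int[mu]_x (w x * h x))%E.
Proof.
move=> nuE wfin mh h0.
pose f_ := nnsfun_approx measurableT mh.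
transitivity (limn (fun n => \int[nu]_x (f_ n x)%:E)%E).
  rewrite -monotone_convergence//.
  - apply: eq_integral => y _; apply/esym/cvg_lim => //.
    by apply: cvg_nnsfun_approx.
  - by move=> n; exact/measurable_EFinP/measurable_funP.
  - by move=> n y _; rewrite lee_fin.
  - by move=> y _ m n mn; rewrite lee_fin; exact/lefP/nd_nnsfun_approx.
transitivity (limn (fun n => \int[mu]_x (w x * (f_ n x)%:E))%E); last first.
  rewrite -monotone_convergence//.
  - apply: eq_integral => y _; rewrite limeMl//.
      by congr (_ * _)%E; apply/cvg_lim => //; exact: cvg_nnsfun_approx.
    by apply/cvg_ex; exists (h y); exact: cvg_nnsfun_approx.
  - move=> n; apply: emeasurable_funM => //.
    exact/measurable_EFinP/measurable_funP.
  - by move=> n y _; rewrite mule_ge0// lee_fin.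
  - move=> y _ m n mn; rewrite lee_wpmul2l// lee_fin.
    exact/lefP/nd_nnsfun_approx.
apply/congr_lim/funext => n.
have mf r : measurable (f_ n @^-1` [set r]) by [].
under eq_integral do rewrite fimfunE -fsumEFin//.
rewrite ge0_integral_fsum//; last 2 first.
- by move=> r; exact/measurable_EFinP/measurable_funM.
- by move=> r x _; rewrite nnfun_muleindic_ge0.
transitivity (\sum_(r \in range (f_ n)) \int[mu]_x
    (r%:E * (w x * (\1_(f_ n @^-1` [set r]) x)%:E)))%E; last first.
  rewrite -ge0_integral_fsum//; last 2 first.
  - move=> r; apply: emeasurable_funM => //; apply: emeasurable_funM => //.
    by apply/measurable_EFinP; exact: measurable_indic.
  - by move=> r x _; rewrite muleCA mule_ge0// nnfun_muleindic_ge0.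
  apply: eq_integral => x _; rewrite [in RHS]fimfunE -fsumEFin//.
  rewrite ge0_mule_fsumr//; last by move=> r; rewrite nnfun_muleindic_ge0.
  by apply: eq_fsbigr => r _; rewrite EFinM muleCA.
apply: eq_fsbigr => r /[!inE] -[x _ fx].
rewrite integralZl_indic_nnsfun// integral_indic// setIT nuE//.
have r0 : 0 <= r by rewrite -fx.
rewrite ge0_integralZl_EFin//; last 2 first.
- by move=> y _; rewrite mule_ge0// lee_fin.
- apply: emeasurable_funM => //.
  by apply/measurable_EFinP; exact: measurable_indic.
congr (_ * _)%E; rewrite integral_mkcond; apply: eq_integral => y _.
rewrite /patch indicE; case: ifP; first by rewrite mule1.
by rewrite mule0.
Qed.

End density_measure.

Lemma integral_deriv_poly (R : realType) (g : {poly R}) (a b : R) : a < b ->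
  (\int[lebesgue_measure]_(x in `]a, b[) (g^`().[x])%:E = (g.[b] - g.[a])%:E)%E.
Proof.
move=> ab.
have mg (A : set R) : measurable_fun A (EFin \o horner g^`()).
  by apply/measurable_EFinP; exact: measurable_poly.
rewrite integral_itv_bndo_bndc//= integral_itv_obnd_cbnd//=.
rewrite (@continuous_FTC2 _ (horner g^`()) (horner g))//.
- by apply: continuous_subspaceT => x; exact: continuous_horner.
- split.
  + by move=> x _; exact: derivable_horner.
  + by apply: cvg_at_right_filter; exact: continuous_horner.
  + by apply: cvg_at_left_filter; exact: continuous_horner.
- by move=> x _; rewrite derivE.
Qed.

(** * The area formula on intervals, then on Borel sets, then with a weight *)

Section area_formula.
Variable R : realType.
Implicit Types (g : {poly R}) (B : set R).

Lemma level_poly_neq0 g y : (1 < size g)%N -> g - y%:P != 0.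
Proof.
move=> sg; rewrite subr_eq0; apply: contraTneq sg => ->.
by rewrite -leqNgt size_polyC leq_b1.
Qed.

Lemma measurable_level_zeros g B : measurable B ->
  measurable_fun [set: R] (fun y => real_zeros_measure (g - y%:P) B).
Proof.
move=> mB; apply: measurable_real_zeros_measure => //.
under eq_fun do rewrite -polyCN.
apply: measurable_polyD; first exact: measurable_poly_cst.
by apply: measurable_polyC; exact: measurable_funN.
Qed.

(** The unweighted left side of the area formula, as a set function. The size argument keeps every
    [g - y%:P] non-zero, which countable additivity relies on. *)
Definition level_measure g (_ : (1 < size g)%N) (B : set (measurableTypeR R)) :
    \bar R :=
  (\int[lebesgue_measure]_y real_zeros_measure (g - y%:P) B)%E.

Section level_measure.
Variables (g : {poly R}) (sg : (1 < size g)%N).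

Local Notation lm := (level_measure sg).

Let lm0 : lm set0 = 0%E.
Proof.
by rewrite /level_measure integral0_eq// => y _; rewrite real_zeros_measure_eq0.
Qed.

Let lm_ge0 A : (0 <= lm A)%E.
Proof. by apply: integral_ge0 => y _; exact: real_zeros_measure_ge0. Qed.

Let lm_sigma_additive : semi_sigma_additive lm.
Proof.
move=> F mF tF mUF; rewrite /level_measure.
under [X in _ --> X]eq_integral do
  rewrite (real_zeros_measure_bigcup (level_poly_neq0 _ sg) mF tF).
rewrite integral_nneseries//; last 2 first.
- by move=> i; have := measurable_level_zeros g (mF i).
- by move=> i y _; exact: real_zeros_measure_ge0.
apply: is_cvg_ereal_nneg_natsum_cond => n _ _; apply: integral_ge0 => y _.
exact: real_zeros_measure_ge0.
Qed.

HB.instance Definition _ := isMeasure.Build _ _ _ lm lm0 lm_ge0 lm_sigma_additive.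

End level_measure.

(** The derivative has constant sign, so [g] is injective on the interval and each level is hit once
    or never: both sides are the length of the image. *)
Let area_monotone g (sg : (1 < size g)%N) (a b : R) : a < b ->
  {in `]a, b[, forall x, ~~ root g^`() x} ->
  level_measure sg `]a, b] =
  (\int[lebesgue_measure]_(x in `]a, b]) `|g^`().[x]|%:E)%E.
Proof.
move=> ab g'0.
have mg (A : set R) : measurable_fun A (fun x => `|g^`().[x]|%:E).
  by apply/measurable_EFinP; apply: measurableT_comp => //; exact: measurable_poly.
rewrite -integral_itv_bndo_bndc//= /level_measure.
have root_level x y : root (g - y%:P) x = (g.[x] == y).
  by rewrite /root hornerD hornerN hornerC subr_eq0.
pose c := (a + b) / 2.
have cab : c \in `]a, b[ by rewrite in_itv/= midf_lt ?midf_lt.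
have aab : a \in `[a, b] by rewrite in_itv/= lexx ltW.
have bab : b \in `[a, b] by rewrite in_itv/= lexx ltW.
have oc x : x \in `]a, b] -> x \in `[a, b].
  by rewrite !in_itv/= => /andP[/ltW-> ->].
have ax x : x \in `]a, b] -> a < x by rewrite in_itv/= => /andP[].
have xb x : x \in `]a, b] -> x <= b by rewrite in_itv/= => /andP[].
have sgE := polyrN0_itv g'0.
have [gc|gc] : 0 < g^`().[c] \/ g^`().[c] < 0.
  by have := g'0 _ cab; rewrite /root neq_lt => /orP[]; [right|left].
- have gpos x : x \in `]a, b[ -> 0 < g^`().[x].
    by move=> xab; rewrite -sgr_gt0 (sgE c x)// sgr_gt0.
  have mono := ltr_horner gpos.
  transitivity (\int[lebesgue_measure]_y (\1_(`]g.[a], g.[b]]%classic : set R) y)%:E)%E.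
    apply: eq_integral => y _; rewrite indicE; have [|yab] := boolP (y \in _).
      rewrite inE/= in_itv/= => /andP[ay yb].
      have [||x /andP[lax lxb]] := @poly_ivt _ (g - y%:P) a b; first exact: ltW.
        by rewrite !hornerE subr_le0 subr_ge0 ltW.
      rewrite root_level => /eqP xy.
      have xab : x \in `]a, b].
        by rewrite in_itv/= lxb lt_neqAle lax !andbT; apply: contraTneq ay => ->; rewrite xy ltxx.
      apply: (@real_zeros_measure_eq1 _ _ _ x) => //.
        by rewrite root_level xy.
      move=> z zab; rewrite root_level => /eqP zy.
      case: (ltgtP z x) => // zx; exfalso; move: zx.
        by rewrite -(mono z x) ?oc// zy xy ltxx.
      by rewrite -(mono x z) ?oc// zy xy ltxx.
    rewrite real_zeros_measure_eq0// => x xab; rewrite root_level.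
    apply: contraNneq yab => <-; rewrite inE/= in_itv/= (mono a x aab (oc x xab))/= (ax x xab)/=.
    by rewrite leNgt (mono b x bab (oc x xab))/= -leNgt (xb x xab).
  rewrite integral_indic//= setIT lebesgue_measure_itv/= lte_fin (mono a b)// ab.
  rewrite -EFinB -integral_deriv_poly//.
  by apply: eq_integral => x /[!inE] /gpos xab; rewrite gtr0_norm.
- have gneg x : x \in `]a, b[ -> g^`().[x] < 0.
    by move=> xab; rewrite -sgr_lt0 (sgE c x)// sgr_lt0.
  have mono := gtr_horner gneg.
  (* A decreasing [g] reverses the interval, so the open end is now at [g.[a]]. *)
  transitivity (\int[lebesgue_measure]_y (\1_(`[g.[b], g.[a][%classic : set R) y)%:E)%E.
    apply: eq_integral => y _; rewrite indicE; have [|yab] := boolP (y \in _).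
      rewrite inE/= in_itv/= => /andP[yb ay].
      have [||x /andP[lax lxb]] := @poly_ivt _ (- (g - y%:P)) a b; first exact: ltW.
        by rewrite !hornerE !opprB subr_le0 subr_ge0 yb ltW.
      rewrite rootN root_level => /eqP xy.
      have xab : x \in `]a, b].
        by rewrite in_itv/= lxb lt_neqAle lax !andbT; apply: contraTneq ay => ->; rewrite xy ltxx.
      apply: (@real_zeros_measure_eq1 _ _ _ x) => //.
        by rewrite root_level xy.
      move=> z zab; rewrite root_level => /eqP zy.
      case: (ltgtP z x) => // zx; exfalso; move: zx.
        by rewrite -(mono x z) ?oc// zy xy ltxx.
      by rewrite -(mono z x) ?oc// zy xy ltxx.
    rewrite real_zeros_measure_eq0// => x xab; rewrite root_level.
    apply: contraNneq yab => <-; rewrite inE/= in_itv/= (mono x a (oc x xab) aab)/= (ax x xab) andbT.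
    by rewrite leNgt (mono x b (oc x xab) bab)/= -leNgt (xb x xab).
  rewrite integral_indic//= setIT lebesgue_measure_itv/= lte_fin (mono b a)// ab.
  rewrite -EFinB (_ : g.[a] - g.[b] = (- g).[b] - (- g).[a]); last first.
    by rewrite !hornerN opprK addrC.
  rewrite -integral_deriv_poly//.
  apply: eq_integral => x /[!inE] /gneg xab.
  by rewrite ltr0_norm// derivN hornerN.
Qed.

(** Both sides are measures in [B], finite on the intervals []-n, n]], so agreement on half-open
    intervals suffices. *)
Lemma level_measureE g (sg : (1 < size g)%N) B : measurable B ->
  level_measure sg B = (\int[lebesgue_measure]_(x in B) `|g^`().[x]|%:E)%E.
Proof.
have g'0 : g^`() != 0.
  by rewrite -size_poly_gt0 polyorder.size_deriv -subn1 subn_gt0.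
have mw : measurable_fun setT (fun x => `|g^`().[x]|%:E).
  by apply/measurable_EFinP; apply: measurableT_comp => //; exact: measurable_poly.
have w0 x : (0 <= `|g^`().[x]|%:E)%E by rewrite lee_fin.
have itv a b : level_measure sg `]a, b] = density_measure lebesgue_measure mw w0 `]a, b].
  have [ba|ab] := leP b a.
    by rewrite set_itv_ge ?measure0// bnd_simp -leNgt.
  (* Induction on the roots of the derivative in []a, b[]: left of the first one [g] is monotone,
     and the rest has one root fewer. *)
  move rE : (roots g^`() a b) => r; elim: r a ab rE => [|x r IH] a ab rE.
    exact: area_monotone ab (roots_nil g'0 rE).
  move/eqP: rE; rewrite roots_cons => /and5P[_ xab /eqP rax _ /eqP rxb].
  move: xab; rewrite in_itv/= => /andP[ax xb].
  have -> : `]a, b]%classic = `]a, x] `|` `]x, b] :> set R.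
    by rewrite -itv_bndbnd_setU// bnd_simp ltW.
  have ab0 : `]a, x] `&` `]x, b] = set0 :> set R.
    apply/seteqP; split=> // z []/=; rewrite !in_itv/= => /andP[_ zx] /andP[xz _].
    by have := lt_le_trans xz zx; rewrite ltxx.
  rewrite !measureU//; congr (_ + _)%E; last exact: IH.
  exact: area_monotone ax (roots_nil g'0 rax).
move=> mB.
pose T n : set R := `](- n%:R), n%:R]%classic.
have fin n : (level_measure sg (T n) < +oo)%E.
  rewrite itv /density_measure integral_itv_obnd_cbnd; last exact: measurable_funTS.
  have /integrable_fin_num : lebesgue_measure.-integrable `[- n%:R : R, n%:R]
      (fun x => `|g^`().[x]|%:E).
    apply: continuous_compact_integrable; first exact: segment_compact.
    apply: continuous_subspaceT => x.
    apply: continuous_comp; first exact: continuous_horner.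
    exact: norm_continuous.
  by rewrite fin_numElt => /(_ _)/andP[|//]; exact: measurable_itv.
have cover : \bigcup_n T n = setT.
  rewrite -subTset => x _; exists (Num.truncn `|x|).+1 => //=.
  by have := truncnS_gt `|x|; rewrite ltr_norml /T/= in_itv/= => /andP[-> /ltW].
have mo : @measurable _ (measurableTypeR R) = <<s @ocitv R >> by [].
have U := @measure_unique _ R (measurableTypeR R) (@ocitv R) T mo (@ocitvI R).
have To n : ocitv (T n) by exists (- n%:R, n%:R).
have {}U := U To cover.
pose l1 : {measure set (measurableTypeR R) -> \bar R} := level_measure sg.
pose l2 : {measure set (measurableTypeR R) -> \bar R} := density_measure lebesgue_measure mw w0.
have l12 A : ocitv A -> l1 A = l2 A by move=> [[a b] _ <-]; exact: itv.
have H := U l1 l2 l12 fin B mB.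
exact: H.
Qed.

End area_formula.

(** Both sides integrate [H] against the image under [g] of the measure with density [|g'|] on [B];
    by the unweighted formula this image has the zero count as density. *)
Lemma area_formula (R : realType) (g : {poly R}) (B : set R) (H : R -> \bar R) :
  measurable B -> measurable_fun [set: R] H -> (forall y, (0 <= H y)%E) ->
  (\int[lebesgue_measure]_y (H y * real_zeros_measure (g - y%:P) B) =
   \int[lebesgue_measure]_(x in B) (`|g^`().[x]|%:E * H g.[x]))%E.
Proof.
move=> mB mH H0; have [sg|sg] := leqP (size g) 1.
  rewrite [RHS]integral0_eq; last first.
    by move=> x _; rewrite (size1_polyC sg) derivC horner0 normr0 mul0e.
  have m1 : measurable ([set g`_0] : set (measurableTypeR R)) by exact: measurable_set1.
  have mHN : measurable_fun [set: measurableTypeR R]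
      (fun y => H y * real_zeros_measure (g - y%:P) B)%E.
    by apply: emeasurable_funM => //; exact: measurable_level_zeros.
  rewrite (ge0_negligible_integral m1 measurableT mHN)//=.
  - rewrite integral0_eq// => y [_ /= /eqP yg].
    rewrite real_zeros_measure_eq0 ?mule0// => x _.
    by rewrite (size1_polyC sg) -polyCB rootC subr_eq0 eq_sym.
  - by move=> y _; rewrite mule_ge0// real_zeros_measure_ge0.
  - exact: lebesgue_measure_set1.
have mg : measurable_fun [set: measurableTypeR R] (horner g : _ -> measurableTypeR R).
  exact: measurable_poly.
have mdg : measurable_fun [set: measurableTypeR R] (fun x => `|g^`().[x]|%:E).
  by apply/measurable_EFinP; apply: measurableT_comp => //; exact: measurable_poly.
pose w (x : measurableTypeR R) := ((\1_B x : R) * `|g^`().[x]|)%:E.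
have w0 x : (0 <= w x)%E by rewrite lee_fin mulr_ge0.
have mw : measurable_fun [set: measurableTypeR R] w.
  rewrite /w; under eq_fun do rewrite EFinM.
  apply: emeasurable_funM => //; apply/measurable_EFinP.
  exact: measurable_indic.
have wE x : w x = if x \in B then `|g^`().[x]|%:E else 0%E.
  by rewrite /w indicE; case: (x \in B); rewrite ?mul1r ?mul0r.
have mgA (A : set (measurableTypeR R)) : measurable A ->
    measurable (horner g @^-1` A : set (measurableTypeR R)).
  by move=> mA; rewrite -[X in measurable X]setTI; exact: mg.
pose nu' : {measure set (measurableTypeR R) -> \bar R} :=
  pushforward (density_measure lebesgue_measure mw w0)
    (horner g : measurableTypeR R -> measurableTypeR R).
pose nu := nu' mg.
have nuE (A : set (measurableTypeR R)) : measurable A -> nu A =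
    (\int[lebesgue_measure]_(y in A) real_zeros_measure (g - y%:P) B)%E.
  move=> mA; rewrite /nu /= /pushforward /density_measure.
  (* A zero of [g - y%:P] lies in the preimage of [A] exactly when [y] is in [A], so intersecting
     with that preimage restricts the levels to [A]. *)
  transitivity (level_measure sg (B `&` horner g @^-1` A)).
    rewrite level_measureE; last by apply: measurableI => //; exact: mgA.
    rewrite integral_mkcond [RHS]integral_mkcond; apply: eq_integral => x _.
    by rewrite /patch wE in_setI andbC; case: (x \in _).
  rewrite /level_measure [RHS]integral_mkcond; apply: eq_integral => y _.
  rewrite /patch; case: ifPn => yA; last first.
    apply: real_zeros_measure_eq0 => x /= [_ Agx].
    apply: contraNN yA; rewrite /root hornerD hornerN hornerC subr_eq0 => /eqP <-.
    exact/mem_set.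
  rewrite /real_zeros_measure; apply: eq_esum => x /=.
  rewrite /root hornerD hornerN hornerC subr_eq0 => /eqP gxy.
  rewrite !diracE in_setI; congr ((nat_of_bool _)%:R%:E).
  by rewrite [X in _ && X]mem_set ?andbT//= gxy; exact/set_mem.
transitivity (\int[nu]_y H y)%E.
  rewrite (ge0_integral_density _ _ nuE)//.
  - by apply: eq_integral => y _; rewrite muleC.
  - by have := measurable_level_zeros g mB.
  - by move=> y; exact: real_zeros_measure_ge0.
  - move=> y; rewrite real_zeros_measure_sum; last exact: level_poly_neq0.
    by under eq_bigr do rewrite diracE; rewrite sumEFin.
rewrite (ge0_integral_pushforward mg)//.
rewrite (@ge0_integral_density _ _ _ lebesgue_measure w)//.
- rewrite [RHS]integral_mkcond; apply: eq_integral => x _.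
  by rewrite /patch wE; case: (x \in B); rewrite ?mul0e.
- exact: measurableT_comp mH mg.
- by move=> x; exact: H0.
Qed.

(** * Polynomials vanishing at given nodes *)

Section interpolant.
Variable R : realType.
Implicit Types (p q : {poly R}) (xs : seq R).

Definition node_poly xs : {poly R} := \prod_(x <- xs) ('X - x%:P).

(* The only polynomial with the same coefficients as [p] from degree [size xs]
   on that vanishes on [xs]: its lower coefficients are the paper's [eta]. *)
Definition interpolant xs p : {poly R} := (p %/ node_poly xs) * node_poly xs.

Lemma size_node_poly xs : size (node_poly xs) = (size xs).+1.
Proof. exact: size_prod_XsubC. Qed.

Lemma node_poly_monic xs : node_poly xs \is monic.
Proof. exact: monic_prod_XsubC. Qed.

Lemma node_poly_neq0 xs : node_poly xs != 0.
Proof. exact/monic_neq0/node_poly_monic. Qed.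

Lemma root_node_poly xs x : root (node_poly xs) x = (x \in xs).
Proof. exact: root_prod_XsubC. Qed.

Lemma node_poly_rcons xs z : node_poly (rcons xs z) = node_poly xs * ('X - z%:P).
Proof. by rewrite /node_poly -cats1 big_cat big_seq1. Qed.

Lemma interpolant_nil p : interpolant [::] p = p.
Proof. by rewrite /interpolant /node_poly big_nil divp1 mulr1. Qed.

Lemma root_interpolant xs p x : x \in xs -> root (interpolant xs p) x.
Proof. by move=> xxs; rewrite rootM root_node_poly xxs orbT. Qed.

Lemma coef_interpolant xs p j : (size xs <= j)%N -> (interpolant xs p)`_j = p`_j.
Proof.
move=> mj; rewrite [p in RHS](divp_eq p (node_poly xs)) coefD.
rewrite [X in _ = _ + X]nth_default ?addr0//.
by rewrite -ltnS (leq_trans (ltn_modpN0 _ (node_poly_neq0 xs))) ?size_node_poly.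
Qed.

(** Coefficients below the degree of the divisor affect only the remainder. *)
Lemma interpolant_low xs p c m : (m < size xs)%N ->
  interpolant xs (p + c *: 'X^m) = interpolant xs p.
Proof.
move=> mx; rewrite /interpolant divpD [X in _ + X]divp_small ?addr0//.
by rewrite (leq_ltn_trans (size_scale_leq _ _))// size_polyXn size_node_poly.
Qed.

Lemma divp_node_poly_addXn xs p c :
  (p + c *: 'X^(size xs)) %/ node_poly xs = p %/ node_poly xs + c%:P.
Proof.
rewrite divpD; congr (_ + _).
(* The node polynomial is monic of degree [size xs], so the difference has lower degree and goes
   into the remainder. *)
have -> : c *: 'X^(size xs) = c%:P * node_poly xs + c *: ('X^(size xs) - node_poly xs).
  by rewrite mul_polyC -scalerDr addrC subrK.
rewrite divp_addl_mul_small//.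
rewrite size_node_poly ltnS (leq_trans (size_scale_leq _ _))//.
apply/leq_sizeP => j; rewrite leq_eqVlt coefB coefXn => /orP[/eqP<-|mj].
  have := monicP (node_poly_monic xs).
  by rewrite /lead_coef size_node_poly/= => ->; rewrite eqxx subrr.
by rewrite nth_default ?size_node_poly// gtn_eqF// subr0.
Qed.

Lemma interpolant_rcons xs z p : interpolant (rcons xs z) p =
  (p %/ node_poly xs - (p %/ node_poly xs).[z]%:P) * node_poly xs.
Proof.
rewrite /interpolant node_poly_rcons -divp_divl.
set G := p %/ node_poly xs.
rewrite [node_poly xs * _]mulrC mulrA; congr (_ * _).
by rewrite [G in RHS](divp_eq G ('X - z%:P)) modp_XsubC// !hornerE subrr mulr0 add0r addrK.
Qed.

(** The coefficient of degree [size xs] is shifted by just the amount that makes the quotient vanish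
    at [z], which turns [z] into a node. *)
Lemma interpolant_addXn xs z p :
  interpolant xs (p + - (p %/ node_poly xs).[z] *: 'X^(size xs)) =
  interpolant (rcons xs z) p.
Proof. by rewrite interpolant_rcons {1}/interpolant divp_node_poly_addXn polyCN. Qed.

Lemma deriv_interpolant_rcons xs z p :
  (interpolant (rcons xs z) p)^`().[z] =
  (p %/ node_poly xs)^`().[z] * (node_poly xs).[z].
Proof.
rewrite interpolant_rcons derivM derivB derivC subr0 !hornerE.
by rewrite subrr mul0r addr0.
Qed.

(** The random variable under the expectation in the formula, Vandermonde factor included, once [q]
    is the interpolant at [xs]. Densities are indexed by [nat] because the number of nodes grows
    during the induction. *)
Definition kac_weight (f : nat -> R -> R) xs q : R :=
  (\prod_(j < size xs) \prod_(i < j) `|xs`_i - xs`_j|^-1) *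
  (\prod_(i < size xs) `|q^`().[xs`_i]|) *
  \prod_(i < size xs) f i q`_i.

Lemma kac_weight_ge0 f xs q : (forall i y, 0 <= f i y) -> 0 <= kac_weight f xs q.
Proof.
by move=> f0; rewrite !mulr_ge0// ?prodr_ge0// => i _; rewrite prodr_ge0.
Qed.

(** The derivative at the new node contains the product of the differences [z - x_i], which cancels
    the new Vandermonde factors; what remains is the Jacobian and density of one area-formula
    step. *)
Lemma kac_weight_rcons f xs z p : z \notin xs ->
  kac_weight f (rcons xs z) (interpolant (rcons xs z) p) =
  `|(p %/ node_poly xs)^`().[z]| *
  (f (size xs) (interpolant (rcons xs z) p)`_(size xs) *
   kac_weight f xs (interpolant (rcons xs z) p)).
Proof.
move=> zxs; set q := interpolant _ _.
rewrite /kac_weight size_rcons !big_ord_recr/=.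
have nthE i : (i < size xs)%N -> (rcons xs z)`_i = xs`_i.
  by move=> ix; rewrite nth_rcons ix.
have zE : (rcons xs z)`_(size xs) = z by rewrite nth_rcons ltnn eqxx.
rewrite [X in X * _ * _ * _](eq_bigr
    (fun j : 'I__ => \prod_(i < j) `|xs`_i - xs`_j|^-1)); last first.
  move=> j _; apply: eq_bigr => i _.
  by rewrite !nthE// (ltn_trans (ltn_ord i)).
rewrite [X in _ * X * _ * _](eq_bigr (fun i : 'I__ => `|xs`_i - z|^-1)); last first.
  by move=> i _; rewrite zE nthE.
rewrite [X in _ * (X * _) * _](eq_bigr (fun i : 'I__ => `|q^`().[xs`_i]|)); last first.
  by move=> i _; rewrite nthE.
rewrite zE deriv_interpolant_rcons.
have -> : `|(p %/ node_poly xs)^`().[z] * (node_poly xs).[z]| =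
    `|(p %/ node_poly xs)^`().[z]| * \prod_(i < size xs) `|xs`_i - z|.
  rewrite normrM; congr (_ * _).
  rewrite /node_poly horner_prod normr_prod (big_nth 0) big_mkord.
  by apply: eq_bigr => i _; rewrite !hornerE distrC.
have : (\prod_(i < size xs) `|xs`_i - z|^-1) * (\prod_(i < size xs) `|xs`_i - z|) = 1.
  rewrite -big_split/= big1// => i _; rewrite mulVf// normr_eq0 subr_eq0.
  by apply: contraNneq zxs => <-; exact: mem_nth.
set a := (\prod_(i < _) _^-1); set b := \prod_(i < _) `|_|; move=> ab.
set v := (\prod_(j < _) \prod_(i < j) _); set w := \prod_(i < _) `|_|.
set h := `|_|; set e := f _ _; set s := \prod_(i < _) _.
transitivity ((a * b) * (h * (e * (v * w * s)))); last by rewrite ab mul1r.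
by ring.
Qed.

End interpolant.

(** * Joint measurability in the nodes and the polynomial *)

Section measurable_interpolant.
Context (d : measure_display) (U : measurableType d) (R : realType).
Variables (Xs : seq (U -> R)).
Hypothesis mXs : forall i, measurable_fun [set: U] (nth (cst 0) Xs i).

Lemma measurable_divp_node_poly (p : U -> {poly R}) : measurable_poly_fun p ->
  measurable_poly_fun (fun u => p u %/ node_poly [seq X u | X <- Xs]).
Proof.
elim: Xs mXs p => [|X Ys IH] mX p mp.
  by under eq_fun do rewrite /node_poly big_nil divp1.
under eq_fun do rewrite /node_poly big_cons -divp_divl.
apply: IH; first by move=> i; exact: (mX i.+1).
by apply: measurable_poly_divp_XsubC => //; exact: (mX 0%N).
Qed.

Lemma measurable_node_poly :
  measurable_poly_fun (fun u => node_poly [seq X u | X <- Xs]).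
Proof.
elim: Xs mXs => [|X Ys IH] mX.
  by under eq_fun do rewrite /node_poly big_nil; exact: measurable_poly_cst.
under eq_fun do rewrite /node_poly big_cons.
apply: measurable_polyM; first by apply: measurable_poly_XsubC; exact: (mX 0%N).
by apply: IH => i; exact: (mX i.+1).
Qed.

Lemma measurable_interpolant (p : U -> {poly R}) : measurable_poly_fun p ->
  measurable_poly_fun (fun u => interpolant [seq X u | X <- Xs] (p u)).
Proof.
move=> mp; apply: measurable_polyM; last exact: measurable_node_poly.
exact: measurable_divp_node_poly.
Qed.

Lemma measurable_kac_weight (f : nat -> R -> R) (q : U -> {poly R}) :
  (forall i, measurable_fun [set: R] (f i)) -> measurable_poly_fun q ->
  measurable_fun [set: U] (fun u => kac_weight f [seq X u | X <- Xs] (q u)).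
Proof.
move=> mf mq; rewrite /kac_weight; under eq_fun do rewrite size_map.
have mx (i : 'I_(size Xs)) : measurable_fun [set: U] (fun u => [seq X u | X <- Xs]`_i).
  under eq_fun do rewrite (nth_map (cst 0))//; exact: mXs.
apply: measurable_funM; first apply: measurable_funM.
- apply: measurable_prod => j _; apply: measurable_prod => i _.
  under eq_fun do rewrite -powR_inv1//.
  have mB : measurable_fun [set: U]
      (fun u => `|[seq X u | X <- Xs]`_i - [seq X u | X <- Xs]`_j|).
    apply: measurableT_comp => //; apply: measurable_funB; last exact: mx.
    exact: (mx (widen_ord (ltnW (ltn_ord j)) i)).
  exact: measurableT_comp (measurable_powR (-1)) mB.
- apply: measurable_prod => i _; apply: measurableT_comp => //.
  by apply: measurable_poly_horner => //; exact: measurable_poly_deriv.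
- apply: measurable_prod => i _; apply: measurableT_comp => //.
  by have [] := mq.
Qed.

End measurable_interpolant.

Lemma emeasurable_prod (d : measure_display) (U : measurableType d) (R : realType)
    (I : Type) (s : seq I) (h : I -> U -> \bar R) :
  (forall i, measurable_fun [set: U] (h i)) ->
  measurable_fun [set: U] (fun u => \prod_(i <- s) h i u)%E.
Proof.
move=> mh; elim: s => [|i s IH].
  by under eq_fun do rewrite big_nil; exact: measurable_cst.
by under eq_fun do rewrite big_cons; exact: emeasurable_funM.
Qed.

Lemma measurable_nth_cst (d : measure_display) (U : measurableType d)
    (R : realType) (xs : seq R) i :
  measurable_fun [set: U] (nth (cst 0) [seq cst x | x <- xs] i).
Proof.
have [ix|ix] := ltnP i (size xs).
  by rewrite (nth_map 0); [exact: measurable_cst|].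
by rewrite nth_default ?size_map//; exact: measurable_cst.
Qed.

Section kac_integrand.
Variables (R : realType) (f : nat -> R -> R).
Hypotheses (mf : forall i, measurable_fun [set: R] (f i))
  (f0 : forall i y, 0 <= f i y).

(** An intermediate stage of the induction: the nodes [xs] have already replaced some of the sets,
    while the sets [B] are still counted. Without nodes it is the product of counts, and without
    sets it is the weight. *)
Definition kac_integrand r (B : 'I_r -> set R) (xs : seq R) (p : {poly R}) : \bar R :=
  ((kac_weight f xs (interpolant xs p))%:E *
   \prod_(i < r) real_zeros_measure (interpolant xs p) (B i))%E.

Lemma kac_integrand_ge0 r (B : 'I_r -> set R) xs p :
  (0 <= kac_integrand B xs p)%E.
Proof.
rewrite mule_ge0 ?lee_fin ?kac_weight_ge0//; apply: prode_ge0 => i _.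
exact: real_zeros_measure_ge0.
Qed.

Lemma measurable_kac_integrand (d : measure_display) (U : measurableType d)
    (Xs : seq (U -> R)) (p : U -> {poly R}) r (B : 'I_r -> set R) :
  (forall i, measurable_fun [set: U] (nth (cst 0) Xs i)) ->
  measurable_poly_fun p -> (forall i, measurable (B i)) ->
  measurable_fun [set: U] (fun u => kac_integrand B [seq X u | X <- Xs] (p u)).
Proof.
move=> mXs mp mB; have mq := measurable_interpolant mXs mp.
apply: emeasurable_funM.
  by apply/measurable_EFinP; exact: measurable_kac_weight.
by apply: emeasurable_prod => i; exact: measurable_real_zeros_measure.
Qed.

Lemma measurable_kac_integrand_cst (d : measure_display) (U : measurableType d)
    (xs : seq R) (p : U -> {poly R}) r (B : 'I_r -> set R) :
  measurable_poly_fun p -> (forall i, measurable (B i)) ->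
  measurable_fun [set: U] (fun u => kac_integrand B xs (p u)).
Proof.
move=> mp mB; rewrite (_ : (fun u => _) = (fun u =>
    kac_integrand B [seq X u | X <- [seq cst x | x <- xs]] (p u))).
  by apply: measurable_kac_integrand => //; exact: measurable_nth_cst.
by apply/funext => u; rewrite -map_comp map_id.
Qed.

Lemma integral_kac_integrand r (B : 'I_r.+1 -> set R) (xs : seq R) (p : {poly R}) :
  (forall i, measurable (B i)) -> (forall x, x \in xs -> ~ B ord0 x) ->
  p`_(size xs) = 0 ->
  (\int[lebesgue_measure]_y
     ((f (size xs) y)%:E * kac_integrand B xs (p + y *: 'X^(size xs))) =
   \int[lebesgue_measure]_(z in B ord0)
     kac_integrand (fun i => B (lift ord0 i)) (rcons xs z) p)%E.
Proof.
move=> mB xsB pm.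
pose G := p %/ node_poly xs.
pose H y := ((f (size xs) y)%:E *
  kac_integrand (fun i => B (lift ord0 i)) xs (p + y *: 'X^(size xs)))%E.
have H0 y : (0 <= H y)%E.
  by rewrite mule_ge0 ?lee_fin// kac_integrand_ge0.
have mH : measurable_fun [set: R] H.
  apply: emeasurable_funM; first exact/measurable_EFinP.
  apply: measurable_kac_integrand_cst => //.
  apply: measurable_polyD; first exact: measurable_poly_cst.
  under eq_fun do rewrite -mul_polyC.
  apply: measurable_polyM; last exact: measurable_poly_cst.
  exact: measurable_polyC.
transitivity (\int[lebesgue_measure]_y
    (H y * real_zeros_measure (- G - y%:P) (B ord0)))%E.
  apply: eq_integral => y _; rewrite /H /kac_integrand big_ord_recl/=.
  (* [B ord0] contains no node, so there the zeros of the interpolant are those of its cofactor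
     [G + y%:P]. *)
  rewrite (@eq_real_zeros_measure _ (interpolant xs _) (- G - y%:P)).
    by rewrite -!muleA; congr (_ * (_ * _))%E; rewrite muleC.
  move=> x Bx; rewrite /interpolant rootM root_node_poly divp_node_poly_addXn.
  by rewrite -opprD rootN; case: (x \in xs) / idP => [/xsB//|_]; rewrite orbF.
rewrite area_formula//; apply: eq_integral => z /[!inE] Bz.
have zxs : z \notin xs by apply/negP => /xsB.
rewrite /H /kac_integrand derivN !hornerN normrN interpolant_addXn.
rewrite kac_weight_rcons// -/G.
(* Because [p] has no term of degree [size xs], the new coefficient is exactly the level at which
   the area formula evaluates the density. *)
have -> : (interpolant (rcons xs z) p)`_(size xs) = - G.[z].
  by rewrite -interpolant_addXn coef_interpolant// coefD pm add0r coefZ coefXn eqxx mulr1.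
by rewrite !EFinM !muleA.
Qed.

End kac_integrand.

(** * Independence and resampling *)

Definition tuple_box (n : nat) (T : Type) (A : 'I_n -> set T) : set (n.-tuple T) :=
  [set t | forall i, A i (tnth t i)].

Definition measurable_boxes (d : measure_display) (T : measurableType d) (n : nat) :
    set (set (n.-tuple T)) :=
  [set tuple_box A | A in [set A : 'I_n -> set T | forall i, measurable (A i)]].

Lemma measurable_boxesI (d : measure_display) (T : measurableType d) (n : nat) :
  setI_closed (@measurable_boxes d T n).
Proof.
move=> _ _ [A mA <-] [B mB <-]; exists (fun i => A i `&` B i).
  by move=> i; exact: measurableI.
apply/seteqP; split=> t /=; first by move=> AB; split=> i; have [] := AB i.
by move=> [At Bt] i; split.
Qed.

Lemma measurable_tuple_box (d : measure_display) (T : measurableType d) (n : nat)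
    (A : 'I_n -> set T) : (forall i, measurable (A i)) -> measurable (tuple_box A).
Proof.
move=> mA; rewrite (_ : tuple_box A = \bigcap_(i in [set: 'I_n]) ((@tnth n T)^~ i @^-1` A i)).
  apply: fin_bigcap_measurable; first exact: finite_finset.
  by move=> i _; rewrite -[X in measurable X]setTI; exact: measurable_tnth.
by apply/seteqP; split=> t /= H i; [move=> _|]; exact: H.
Qed.

(** A coordinate preimage is a box whose other sides are [setT], so boxes form a generating family,
    closed under intersection. *)
Lemma measurable_tupleE (d : measure_display) (T : measurableType d) (n : nat) :
  @measurable _ (n.-tuple T) = <<s @measurable_boxes d T n >>.
Proof.
apply/seteqP; split; last first.
  apply: smallest_sub; first exact: sigma_algebra_measurable.
  by move=> _ [A mA <-]; exact: measurable_tuple_box.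
apply: smallest_sub; first exact: smallest_sigma_algebra.
move=> C; rewrite -bigcup_seq/= => -[i _ [A mA <-]].
apply: sub_sigma_algebra; exists (fun j => if j == i then A else setT).
  by move=> j; case: ifP.
apply/seteqP; split=> t /=.
  by move=> /(_ i); rewrite eqxx.
by move=> [_ At] j; case: eqP => // ->.
Qed.

Lemma measurable_preimageT (d1 d2 : measure_display) (T1 : measurableType d1)
    (T2 : measurableType d2) (g : T1 -> T2) (A : set T2) :
  measurable_fun [set: T1] g -> measurable A -> measurable (g @^-1` A).
Proof. by move=> mg mA; rewrite -[X in measurable X]setTI; exact: mg. Qed.

Section independence.
Context (d d' : measure_display) (T : measurableType d) (S : measurableType d')
  (R : realType) (P : probability T R) (n : nat).
Variables (X : {mfun T >-> S}) (Z : {mfun T >-> n.-tuple R}).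
Hypothesis indep : forall (A : set S) (B : 'I_n -> set R), measurable A ->
  (forall i, measurable (B i)) ->
  P (X @^-1` A `&` Z @^-1` tuple_box B) =
  (P (X @^-1` A) * P (Z @^-1` tuple_box B))%E.

(** For fixed [A] both sides are finite measures in [C] that agree on boxes. *)
Lemma indep_preimage (A : set S) (C : set (n.-tuple R)) :
  measurable A -> measurable C ->
  P (X @^-1` A `&` Z @^-1` C) = (P (X @^-1` A) * P (Z @^-1` C))%E.
Proof.
move=> mA mC.
have mXA : measurable (X @^-1` A) by exact: measurable_preimageT.
have mZ : measurable_fun [set: T] Z by [].
pose nu1' : {measure set (n.-tuple R) -> \bar R} := pushforward (mrestr P mXA) Z.
have r0 : 0 <= fine (P (X @^-1` A)) by rewrite fine_ge0.
pose nu2 : {measure set (n.-tuple R) -> \bar R} := mscale (NngNum r0) (distribution P Z).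
have PXA : P (X @^-1` A) \is a fin_num by exact: fin_num_measure.
have nu1E D : nu1' mZ D = P (X @^-1` A `&` Z @^-1` D).
  by rewrite /nu1' /= /pushforward /mrestr setIC.
have nu2E D : nu2 D = (P (X @^-1` A) * P (Z @^-1` D))%E.
  by rewrite /nu2 /= /mscale/= fineK.
rewrite -nu1E -nu2E.
apply: (measure_unique (@measurable_boxes _ R n) (fun=> setT)) => //.
- exact: measurable_tupleE.
- exact: measurable_boxesI.
- by move=> _; exists (fun=> setT) => //; apply/seteqP; split.
- by rewrite bigcup_const//; exists 0%N.
- by move=> _ [B mB <-]; rewrite nu1E nu2E indep.
- move=> _; rewrite nu1E ltey_eq fin_num_measure//.
  apply: measurableI => //; exact: measurable_preimageT.
Qed.

(** By independence the joint law is the product of the laws, and Tonelli applies. *)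
Lemma ge0_integral_indep (F : S * n.-tuple R -> \bar R) (Q : probability S R) :
  (forall A, measurable A -> Q A = P (X @^-1` A)) ->
  measurable_fun [set: S * n.-tuple R] F -> (forall u, (0 <= F u)%E) ->
  (\int[P]_w F (X w, Z w) = \int[P]_w \int[Q]_y F (y, Z w))%E.
Proof.
move=> QE mF F0.
have mXZ : measurable_fun [set: T] (fun w => (X w, Z w)) by exact: measurable_fun_pair.
pose nu' : {measure set (S * n.-tuple R) -> \bar R} := pushforward P (fun w => (X w, Z w)).
pose muZ := distribution P Z.
have prodE (W : set (S * n.-tuple R)) : measurable W -> (Q \x muZ)%E W = nu' mXZ W.
  apply: product_measure_unique => A C mA mC.
  have H := indep_preimage mA mC; rewrite -(QE _ mA) in H; exact: H.
transitivity (\int[nu' mXZ]_u F u)%E.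
  by rewrite (ge0_integral_pushforward mXZ).
transitivity (\int[(Q \x muZ)%E]_u F u)%E.
  by apply: eq_measure_integral => W mW _; rewrite -prodE.
rewrite fubini_tonelli2//.
rewrite ge0_integral_distribution//.
  exact: measurable_fun_fubini_tonelli_G.
by move=> y; apply: integral_ge0.
Qed.

End independence.

(** * Resampling one coefficient *)

Section resampling.
Context (d : measure_display) (T : measurableType d) (R : realType)
  (P : probability T R) (n : nat).
Variables (xi : 'I_n -> {RV P >-> R}) (f : 'I_n -> R -> R).
Hypotheses (xi_indep : mutually_independent xi)
  (xi_density : forall j, has_density (xi j) (f j)).

(** The coordinate is set to 0 rather than removed, so that indices need no shift and the tuple
    still encodes a polynomial, now without its term of degree [m]. *)
Definition erase_coord (m : 'I_n) (w : T) : n.-tuple R :=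
  [tuple if j == m then 0 else xi j w | j < n].

Lemma measurable_erase_coord m : measurable_fun [set: T] (erase_coord m).
Proof.
apply/measurable_fun_tnthP => j.
rewrite (_ : _ \o _ = fun w => if j == m then 0 else xi j w).
  by case: (j == m); [exact: measurable_cst|exact: measurable_funPT].
by apply/funext => w /=; rewrite tnth_mktuple.
Qed.

Let indep_erase_coord m (A : set R) (B : 'I_n -> set R) : measurable A ->
  (forall i, measurable (B i)) ->
  P (xi m @^-1` A `&` erase_coord m @^-1` tuple_box B) =
  (P (xi m @^-1` A) * P (erase_coord m @^-1` tuple_box B))%E.
Proof.
(* The erased coordinate is constantly 0, so the box event is empty unless [B m] contains 0. *)
move=> mA mB; have [B0|B0] := pselect (B m 0); last first.
  have -> : erase_coord m @^-1` tuple_box B = set0.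
    by apply/seteqP; split=> // w H; have := H m; rewrite tnth_mktuple eqxx.
  by rewrite setI0 measure0 mule0.
pose C (A : set R) j := if j == m then A else B j.
have mC D : measurable D -> forall j, measurable (C D j).
  by move=> mD j; rewrite /C; case: ifP.
have PC D : measurable D -> P (xi m @^-1` D `&` erase_coord m @^-1` tuple_box B) =
    (P (xi m @^-1` D) * \prod_(j < n | j != m) P (xi j @^-1` B j))%E.
  move=> mD; have := xi_indep [set: 'I_n]%SET (mC _ mD).
  rewrite (bigD1 m) ?inE//= {2}/C eqxx => CE.
  transitivity (P (\bigcap_(i in [set` [set: 'I_n]%SET]) (xi i @^-1` C D i))).
    congr (P _); apply/seteqP; split=> w /=.
      move=> [Dw Bw] j _ /=; rewrite /C; case: eqP => [->//|/eqP jm].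
      by have := Bw j; rewrite tnth_mktuple (negbTE jm).
    move=> H; split; first by have := H m (finset.in_setT _); rewrite /C eqxx.
    move=> j; rewrite tnth_mktuple; case: eqP => [->//|/eqP jm].
    by have := H j (finset.in_setT _); rewrite /C (negbTE jm).
  rewrite CE; congr (_ * _)%E; apply: eq_big => [j|j]; first by rewrite !inE.
  by rewrite !inE /C => /negbTE ->.
rewrite PC//; congr (_ * _)%E.
(* The case [D = setT] gives the probability of the box event alone. *)
by have := PC setT measurableT; rewrite preimage_setT setTI probability_setT mul1e => ->.
Qed.

Lemma expectation_resample (m : 'I_n) (F : R -> n.-tuple R -> \bar R) :
  measurable_fun [set: measurableTypeR R * n.-tuple R] (fun u => F u.1 u.2) ->
  (forall y z, (0 <= F y z)%E) ->
  (\int[P]_w F (xi m w) (erase_coord m w) =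
   \int[P]_w \int[lebesgue_measure]_y ((f m y)%:E * F y (erase_coord m w)))%E.
Proof.
move=> mF F0; have [mfm fm0 fmE] := xi_density m.
have mX : measurable_fun [set: T] (xi m : T -> measurableTypeR R) by have := measurable_funPT (xi m).
pose mXm := isMeasurableFun.Build _ _ _ _ _ mX.
pose X : {mfun T >-> measurableTypeR R} := HB.pack (xi m : T -> measurableTypeR R) mXm.
pose mZm := isMeasurableFun.Build _ _ _ _ _ (measurable_erase_coord m).
pose Z : {mfun T >-> n.-tuple R} := HB.pack (erase_coord m) mZm.
have XZ (A : set (measurableTypeR R)) B : measurable A -> (forall i, measurable (B i)) ->
    P (X @^-1` A `&` Z @^-1` tuple_box B) =
    (P (X @^-1` A) * P (Z @^-1` tuple_box B))%E.
  by move=> mA mB; exact: indep_erase_coord.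
rewrite -[LHS]/(\int[P]_w (fun u => F u.1 u.2) (X w, Z w))%E.
rewrite (@ge0_integral_indep _ _ _ _ _ P n X Z XZ _ (distribution P X))//.
apply: eq_integral => w _ /=.
rewrite (@ge0_integral_density _ (measurableTypeR R) R lebesgue_measure (EFin \o f m))//.
- exact/measurable_EFinP.
- have mp : measurable_fun [set: measurableTypeR R] (fun y => (y, erase_coord m w)).
    exact: measurable_fun_pair.
  by have := measurableT_comp mF mp.
Qed.

End resampling.

(** * The correlation functions *)

Lemma eq_iterated_integral (R : realType) (k : nat) (B : 'I_k -> set R)
    (F1 F2 : k.-tuple R -> \bar R) :
  (forall y : k.-tuple R, (forall i, B i (tnth y i)) -> F1 y = F2 y) ->
  iterated_integral B F1 = iterated_integral B F2.
Proof.
elim: k B F1 F2 => [|k IH] B F1 F2 F12 /=; first by apply: F12 => -[].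
apply: eq_integral => x /[!inE] Bx; apply: IH => y By; apply: F12 => i.
by case: (unliftP ord0 i) => [j|] ->; rewrite ?tnthS.
Qed.

Lemma coef_poly_of_coefs (R : realType) (n : nat) (c : 'I_n.+1 -> R) (j : 'I_n.+1) : (poly_of_coefs c)`_j = c j.
Proof.
rewrite coef_sum (bigD1 j)//= coefZ coefXn eqxx mulr1 big1 ?addr0// => i ij.
by rewrite coefZ coefXn eq_sym (inj_eq val_inj) (negbTE ij) mulr0.
Qed.

Section kac_rice.
Context (d : measure_display) (T : measurableType d) (R : realType)
  (P : probability T R) (n : nat).
Variables (xi : 'I_n.+1 -> {RV P >-> R}) (f : 'I_n.+1 -> R -> R).
Hypotheses (xi_indep : mutually_independent xi)
  (xi_density : forall j, has_density (xi j) (f j)).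

Let p (w : T) := poly_of_coefs (fun j => xi j w).
Let fn (i : nat) : R -> R := f (inord i).

Let mfn i : measurable_fun [set: R] (fn i).
Proof. by have [] := xi_density (inord i). Qed.

Let fn0 i y : 0 <= fn i y.
Proof. by have [_ + _] := xi_density (inord i); exact. Qed.

Lemma measurable_poly_of_coefs (d' : measure_display) (U : measurableType d')
    (c : 'I_n.+1 -> U -> R) : (forall j, measurable_fun [set: U] (c j)) ->
  measurable_poly_fun (fun u => poly_of_coefs (fun j => c j u)).
Proof.
move=> mc; apply: measurable_poly_sum => j.
under eq_fun do rewrite -mul_polyC.
apply: measurable_polyM; last exact: measurable_poly_cst.
exact: measurable_polyC (mc j).
Qed.

Let poly_erase (m : 'I_n.+1) w :
  p w = poly_of_coefs (tnth (erase_coord xi m w)) + xi m w *: 'X^m.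
Proof.
rewrite /p /poly_of_coefs (bigD1 m)//= addrC; congr (_ + _).
rewrite [RHS](bigD1 m)//= tnth_mktuple eqxx scale0r add0r.
by apply: eq_bigr => j /negbTE jm; rewrite tnth_mktuple jm.
Qed.

Lemma expectation_kac_integrand r (B : 'I_r.+1 -> set R) (xs : seq R) :
  (forall i, measurable (B i)) -> (forall x, x \in xs -> ~ B ord0 x) ->
  (size xs <= n)%N ->
  (\int[P]_w kac_integrand fn B xs (p w) =
   \int[lebesgue_measure]_(z in B ord0)
     \int[P]_w kac_integrand fn (fun i => B (lift ord0 i)) (rcons xs z) (p w))%E.
Proof.
move=> mB xsB; rewrite -ltnS => xsn; pose m := Ordinal xsn.
pose F y (z : n.+1.-tuple R) := kac_integrand fn B xs (poly_of_coefs (tnth z) + y *: 'X^m).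
(* The indicator extends the inner integrand to the whole product space, where Tonelli is
   applied. *)
pose K (u : T * measurableTypeR R) := ((\1_(B ord0) u.2 : R)%:E *
  kac_integrand fn (fun i => B (lift ord0 i)) (rcons xs u.2) (p u.1))%E.
have KE w z : K (w, z) = ((fun z => kac_integrand fn (fun i => B (lift ord0 i))
    (rcons xs z) (p w)) \_ (B ord0)) z.
  by rewrite /K /patch /= indicE; case: (z \in _); rewrite ?mul1e ?mul0e.
transitivity (\int[P]_w F (xi m w) (erase_coord xi m w))%E.
  by apply: eq_integral => w _; rewrite /F -poly_erase.
rewrite (expectation_resample xi_indep xi_density); last 2 first.
- rewrite /F.
  apply: measurable_kac_integrand_cst => //.
  apply: measurable_polyD.
    apply: (measurable_poly_of_coefs (c := fun j u => tnth u.2 j)) => j.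
    apply: (measurableT_comp (measurable_tnth j)); exact: measurable_snd.
  under eq_fun do rewrite -mul_polyC.
  apply: measurable_polyM; last exact: measurable_poly_cst.
  exact: (measurable_polyC measurable_fst).
- by move=> y z; exact: kac_integrand_ge0.
transitivity (\int[P]_w \int[lebesgue_measure]_z K (w, z))%E.
  apply: eq_integral => w _.
  have mE : (m : nat) = size xs by [].
  have -> : f m = fn (size xs) by rewrite /fn -mE inord_val.
  rewrite /F integral_kac_integrand//; last first.
    by rewrite -mE coef_poly_of_coefs tnth_mktuple eqxx.
  rewrite integral_mkcond; apply: eq_integral => z _; rewrite KE /patch.
  case: ifP => // _; rewrite /kac_integrand.
  (* With [m.+1] nodes the interpolant ignores the coefficient of degree [m], so the erased
     polynomial may be replaced by the full one. *)
  by rewrite (poly_erase m w) interpolant_low// size_rcons.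
rewrite fubini_tonelli.
- rewrite [RHS]integral_mkcond; apply: eq_integral => z _.
  rewrite /patch; case: ifPn => zB.
    by apply: eq_integral => w _; rewrite KE /patch zB.
  by rewrite integral0_eq// => w _; rewrite KE /patch (negbTE zB).
- apply: emeasurable_funM.
    apply/measurable_EFinP; apply: measurableT_comp; last exact: measurable_snd.
    by apply: measurable_indic; exact: (mB ord0).
  rewrite (_ : (fun u => _) = (fun u : T * measurableTypeR R =>
      kac_integrand fn (fun i => B (lift ord0 i))
        [seq X u | X <- rcons [seq cst x | x <- xs] (snd : _ -> R)] (p u.1))).
  apply: measurable_kac_integrand => //.
    move=> i; rewrite nth_rcons size_map; case: ltnP => _.
      exact: measurable_nth_cst.
    case: eqP => _; last exact: measurable_cst.
    exact: measurable_snd.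
  apply: (measurable_poly_of_coefs (c := fun j u => xi j u.1)) => j.
  by apply: measurableT_comp.
  by apply/funext => u; rewrite map_rcons -map_comp map_id.
- by move=> u; rewrite mule_ge0 ?lee_fin// kac_integrand_ge0.
Qed.

(** Each step turns the first remaining set into a node. Disjointness keeps the later sets away from
    it, and the size bound leaves a fresh coefficient for every step. *)
Lemma iterated_kac_weight r (B : 'I_r -> set R) (xs : seq R) :
  (forall i, measurable (B i)) ->
  (forall i j, i != j -> B i `&` B j = set0) ->
  (forall i x, x \in xs -> ~ B i x) -> (size xs + r <= n.+1)%N ->
  (\int[P]_w kac_integrand fn B xs (p w) =
   iterated_integral B (fun y : r.-tuple R =>
     \int[P]_w (kac_weight fn (xs ++ y) (interpolant (xs ++ y) (p w)))%:E))%E.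
Proof.
elim: r B xs => [|r IH] B xs mB dB xsB xsn /=.
  by apply: eq_integral => w _; rewrite /kac_integrand big_ord0 mule1 cats0.
rewrite expectation_kac_integrand//; last 2 first.
- exact: xsB.
- by rewrite -ltnS (leq_trans _ xsn)// addnS ltnS leq_addr.
apply: eq_integral => z /[!inE] Bz; rewrite IH//.
- by congr iterated_integral; apply/funext => y; rewrite -cats1 -catA.
- by move=> i j ij; apply: dB; rewrite (inj_eq lift_inj).
- move=> i x; rewrite mem_rcons inE => /orP[/eqP-> Biz|/xsB]; last exact.
  have /seteqP[/(_ z)] : B ord0 `&` B (lift ord0 i) = set0 by apply: dB.
  by move=> /(_ (conj Bz Biz)).
- by rewrite size_rcons addSnnS.
Qed.

End kac_rice.

(** * The Vandermonde system and the explicit form of the weight *)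

Lemma vandermonde_mx_unit (R : realType) (k : nat) (x : k.-tuple R) :
  uniq x -> vandermonde_mx x \in unitmx.
Proof.
move=> ux; rewrite -unitmx_tr unitmxE unitfE.
have -> : (vandermonde_mx x)^T = Vandermonde k (\row_i tnth x i).
  by apply/matrixP => i j; rewrite !mxE.
rewrite det_Vandermonde; apply/prodf_neq0 => i _; apply/prodf_neq0 => j ij.
rewrite !mxE subr_eq0 (inj_eq (tuple_uniqP _ ux)).
by apply: contraTneq ij => ->; rewrite ltnn.
Qed.

Section eta.
Context (R : realType) (n k : nat).
Hypothesis kn : (k <= n)%N.
Variables (c : 'I_n.+1 -> R) (x : k.-tuple R).
Hypothesis ux : uniq x.

Let q := interpolant x (poly_of_coefs c).

Let coef_q (j : 'I_n.+1) : (k <= j)%N -> q`_j = c j.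
Proof. by move=> kj; rewrite coef_interpolant ?size_tuple// coef_poly_of_coefs. Qed.

Let size_q : (size q <= n.+1)%N.
Proof.
apply/leq_sizeP => j nj.
rewrite coef_interpolant ?size_tuple; last by rewrite (leq_trans _ nj)// leqW.
rewrite coef_sum big1// => i _.
by rewrite coefZ coefXn gtn_eqF ?mulr0// (leq_trans (ltn_ord i)).
Qed.

Let sum_split (F : nat -> R) : \sum_(j < n.+1) F j =
  \sum_(j < k) F j + \sum_(j < n.+1 | (k <= j)%N) F j.
Proof.
rewrite (bigID (fun j : 'I_n.+1 => (j < k)%N))/=; congr (_ + _).
  by rewrite (big_ord_widen n.+1 F (leqW kn)).
by apply: eq_bigl => j; rewrite -leqNgt.
Qed.

(** Vanishing of the interpolant at the nodes is a linear system for its low coefficients, with the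
    invertible Vandermonde matrix and the high-degree terms on the right. *)
Lemma eta_col_interpolant (i : 'I_k) : eta_col c x i 0 = q`_i.
Proof.
pose E : 'cV[R]_k := \col_j q`_j.
have VE : vandermonde_mx x *m E =
    - \col_(i < k) \sum_(j < n.+1 | (k <= j)%N) c j * tnth x i ^+ j.
  apply/matrixP => a b; rewrite !mxE; apply/eqP; rewrite -addr_eq0; apply/eqP.
  transitivity (q.[tnth x a]); last by apply/rootP/root_interpolant/mem_tnth.
  rewrite (horner_coef_wide _ size_q) (sum_split (fun j => q`_j * tnth x a ^+ j)).
  congr (_ + _); apply: eq_bigr => j kj; first by rewrite !mxE mulrC.
  by rewrite coef_q.
rewrite /eta_col mulNmx -mulmxN -VE mulKmx ?vandermonde_mx_unit//.
by rewrite mxE.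
Qed.

Lemma deriv_interpolant_eta (i : 'I_k) : q^`().[tnth x i] =
  \sum_(j < k) j%:R * eta_col c x j 0 * tnth x i ^+ j.-1 +
  \sum_(j < n.+1 | (k <= j)%N) j%:R * c j * tnth x i ^+ j.-1.
Proof.
transitivity (\sum_(j < n.+1) j%:R * q`_j * tnth x i ^+ j.-1).
  (* The term [j = 0] vanishes through its factor 0, even though [j.-1] truncates to 0; the others
     shift down by one degree. *)
  rewrite big_ord_recl mul0r mul0r add0r (@horner_coef_wide _ n).
    by apply: eq_bigr => j _; rewrite coef_deriv mulr_natl.
  apply/leq_sizeP => j nj; rewrite coef_deriv nth_default ?mul0rn//.
  exact: leq_trans size_q _.
rewrite (sum_split (fun j => j%:R * q`_j * tnth x i ^+ j.-1)).
congr (_ + _); apply: eq_bigr => j kj; first by rewrite eta_col_interpolant.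
by rewrite coef_q.
Qed.

Lemma kac_weight_eta (f : 'I_n.+1 -> R -> R) :
  kac_weight (fun i => f (inord i)) x q =
  (\prod_(i < k) \prod_(j < k | (i < j)%N) `|tnth x i - tnth x j|^-1) *
  (\prod_(i < k) `| \sum_(j < k) j%:R * eta_col c x j 0 * tnth x i ^+ j.-1 +
     \sum_(j < n.+1 | (k <= j)%N) j%:R * c j * tnth x i ^+ j.-1 | *
   \prod_(i < k) f (widen_ord (leqW kn) i) (eta_col c x i 0)).
Proof.
rewrite /kac_weight size_tuple -mulrA; congr (_ * (_ * _)).
- rewrite (exchange_big_dep xpredT)//=; apply: eq_bigr => j _.
  rewrite (big_ord_widen k (fun i => `|x`_i - x`_j|^-1) (ltnW (ltn_ord j))).
  by apply: eq_bigr => i _; rewrite !(tnth_nth 0).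
- by apply: eq_bigr => i _; rewrite -deriv_interpolant_eta (tnth_nth 0).
- apply: eq_bigr => i _; rewrite eta_col_interpolant; congr (f _ _).
  by apply: val_inj; rewrite /= inordK// (leq_trans (ltn_ord i))// leqW.
Qed.

End eta.

(** * The formula is a version of the correlation function *)

Theorem theorem2p1 (R : realType) (d : measure_display)
    (T : measurableType d) (P : probability T R) (n : nat) (hn : (1 <= n)%N)
    (xi : 'I_n.+1 -> {RV P >-> R}) (f : 'I_n.+1 -> R -> R)
    (xi_indep : mutually_independent xi)
    (xi_density : forall j, has_density (xi j) (f j))
    (k : nat) (hk : (1 <= k)%N) (hkn : (k <= n)%N)
    (rho : k.-tuple R -> \bar R)
    (rhoE : forall x : k.-tuple R, uniq x ->
      (rho x =
       (\prod_(i < k) \prod_(j < k | (i < j)%N)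
          `|tnth x i - tnth x j|^-1)%R%:E *
       'E_P[(fun w : T =>
          (\prod_(i < k)
             `| \sum_(j < k)
                   j%:R * eta_col (fun l => xi l w) x j 0 * tnth x i ^+ j.-1
                + \sum_(j < n.+1 | (k <= j)%N)
                   j%:R * xi j w * tnth x i ^+ j.-1 |)
          * \prod_(i < k)
              f (widen_ord (leqW hkn) i) (eta_col (fun l => xi l w) x i 0))%R])%E) :
  is_correlation_function P
    (fun w => real_zeros_measure (poly_of_coefs (fun j => xi j w))) rho.
Proof.
pose p w := poly_of_coefs (fun j => xi j w).
pose fn i := f (inord i).
have mfn i : measurable_fun [set: R] (fn i) by have [] := xi_density (inord i).
have fn0 i y : 0 <= fn i y by have [_ + _] := xi_density (inord i); exact.
have mxi j : measurable_fun [set: T] (xi j) by exact: measurable_funPT.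
pose Phi (u : k.-tuple R * T) := (kac_weight fn u.1 (interpolant u.1 (p u.2)))%:E.
have Phi0 u : (0 <= Phi u)%E by rewrite lee_fin kac_weight_ge0.
have mPhi : measurable_fun [set: k.-tuple R * T] Phi.
  apply/measurable_EFinP.
  (* The nodes are treated as coordinate projections, which gives joint measurability in the tuple
     and the sample point. *)
  pose Xs := [seq (fun u : k.-tuple R * T => tnth u.1 i) | i <- enum 'I_k].
  have XsE u : [seq X u | X <- Xs] = u.1.
    rewrite -map_comp; exact: map_tnth_enum.
  have mXs i : measurable_fun [set: k.-tuple R * T] (nth (cst 0) Xs i).
    have sX : size Xs = k by rewrite size_map size_enum_ord.
    have [ik|ik] := ltnP i k; last first.
      by rewrite nth_default ?sX//; exact: measurable_cst.
    rewrite (nth_map (Ordinal ik)) ?size_enum_ord//.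
    exact: (measurableT_comp (measurable_tnth _) measurable_fst).
  rewrite (_ : (fun u => _) = (fun u => kac_weight fn [seq X u | X <- Xs]
      (interpolant [seq X u | X <- Xs] (p u.2)))).
    apply: measurable_kac_weight => //; apply: measurable_interpolant => //.
    apply: (measurable_poly_of_coefs (c := fun j u => xi j u.2)) => j.
    exact: measurableT_comp.
  by apply/funext => u; rewrite XsE.
have rhoPhi (x : k.-tuple R) : uniq x -> rho x = (\int[P]_w Phi (x, w))%E.
  move=> ux; rewrite rhoE// expectation.unlock -ge0_integralZl_EFin//.
  - apply: eq_integral => w _; rewrite /Phi/= -EFinM.
    by rewrite (kac_weight_eta hkn).
  - move=> w _; rewrite lee_fin mulr_ge0// prodr_ge0// => i _.
    by have [_ + _] := xi_density (widen_ord (leqW hkn) i); exact.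
  (* Distinct coordinates make [c] non-zero, so measurability of the random variable follows by
     dividing [Phi] by [c]. *)
  - pose c : R := \prod_(i < k) \prod_(j < k | (i < j)%N) `|tnth x i - tnth x j|^-1.
    have c0 : c != 0.
      apply/prodf_neq0 => i _; apply/prodf_neq0 => j ij.
      rewrite invr_neq0// normr_eq0 subr_eq0 (inj_eq (tuple_uniqP _ ux)).
      by apply: contraTneq ij => ->; rewrite ltnn.
    have mx : measurable_fun [set: T] (fun w => (x, w)) by exact: measurable_fun_pair.
    rewrite (_ : (fun w => _) = (fun w => c^-1%:E * Phi (x, w))%E).
      by apply: emeasurable_funM => //; have := measurableT_comp mPhi mx.
    by apply/funext => w; rewrite /Phi/= (kac_weight_eta hkn)// -EFinM -/c mulKf.
  - by apply: prodr_ge0 => i _; apply: prodr_ge0.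
split.
- by move=> x ux; rewrite rhoPhi//; apply: integral_ge0.
- apply: (@eq_measurable_fun _ _ _ _ _ (fubini_F P Phi)).
    by move=> x /[!inE] ux; rewrite rhoPhi.
  by apply: measurable_funTS; exact: measurable_fun_fubini_tonelli_F.
- move=> B mB dB.
  (* Without nodes the interpolant is [p w] itself and the weight is an empty product. *)
  have prodE w : (\prod_(i < k) real_zeros_measure (p w) (B i))%E =
      kac_integrand fn B [::] (p w).
    rewrite /kac_integrand interpolant_nil /kac_weight !big_ord0 !mulr1 mul1e//.
  split.
    apply: emeasurable_prod => i; apply: measurable_real_zeros_measure => //.
    exact: (measurable_poly_of_coefs (c := fun j u => xi j u)).
  rewrite (eq_integral _ _ (fun w _ => prodE w)).
  rewrite (iterated_kac_weight xi_indep xi_density)//; last by rewrite /= leqW.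
  apply: eq_iterated_integral => x Bx; rewrite rhoPhi//.
  (* Points of a product of disjoint sets have distinct coordinates, so the formula for [rho]
     applies to them. *)
  apply/tuple_uniqP => i j xij; apply/eqP/negPn/negP => ij.
  have /seteqP[/(_ (tnth x i))] := dB _ _ ij.
  by case; split => //; rewrite xij.
Qed.
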